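(* Let $\mathcal G$ be a completely solvable Lie algebra over a field $K$ of characteristic zero, let $A$ be a prime factor algebra of the universal enveloping algebra $U(\mathcal G)$, and let $a\in A$. Then, for an arbitrary polynomial $f(t)\in K[t]$ of degree $>1$, $0$ is the only eigenvalue of the inner derivation $\operatorname{ad} f(a)$ of $A$; that is, if $[f(a),b]=\lambda b$ for some $\lambda\in K$ and $0\ne b\in A$, then $\lambda=0$.
   Context: Lie algebras are finite dimensional. A Lie algebra $\mathcal G$ over $K$ is completely solvable if it has a chain of ideals $0=\mathcal G_0\subset\mathcal G_1\subset\cdots\subset\mathcal G_n=\mathcal G$ with $\dim_K\mathcal G_i=i$. A prime factor algebra of $U(\mathcal G)$ is a quotient by a prime two-sided ideal. $\operatorname{ad} u$ is the inner derivation $b\mapsto[u,b]=ub-bu$. *)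

(* Defs.v *)
From HB Require Import structures.
From mathcomp Require Import all_boot all_algebra.
From mathcomp Require Import boolp.
From mathcomp Require Import monalg.

Set Implicit Arguments.
Unset Strict Implicit.
Unset Printing Implicit Defensive.

Import GRing.Theory.
Local Open Scope ring_scope.
Local Open Scope quotient_scope.

(* Two-sided ideals; the improper ideal is allowed. *)
Definition ideal2_closed (R : nzRingType) (I : {pred R}) : Prop :=
  [/\ 0 \in I,
      {in I &, forall u v, u - v \in I},
      forall a, {in I, forall u, a * u \in I}
    & forall a, {in I, forall u, u * a \in I}].

HB.mixin Record isRightMulStable (R : nzRingType) (I : R -> bool) := {
  ideal2_mulr_subproof : forall a u, u \in I -> u * a \in I
}.

(* [idealr] only asks for stability under left multiplication and properness,
   so these are the proper two-sided ideals. *)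
#[short(type="proper_ideal2")]
HB.structure Definition ProperIdeal2 (R : nzRingType) :=
  {I of Idealr R I & isRightMulStable R I}.

Lemma ideal2_idealr_closed (R : nzRingType) (I : {pred R}) :
  ideal2_closed I -> 1 \notin I -> idealr_closed I.
Proof.
case=> I0 IB Il _ I1; split=> // a u v uI vI.
by rewrite -[v]opprK IB ?Il // -[- v]sub0r IB.
Qed.

Definition prime_ideal2 (R : nzRingType) (P : {pred R}) : Prop :=
  [/\ ideal2_closed P, 1 \notin P
    & forall I J : {pred R}, ideal2_closed I -> ideal2_closed J ->
        (forall u v, u \in I -> v \in J -> u * v \in P) ->
        {subset I <= P} \/ {subset J <= P}].

(* The library makes [{quot I}] a ring only over commutative rings; hence an
   alias carrying the algebra structure of the quotient by a two-sided ideal. *)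
Section AlgebraQuotient.
Variables (K : fieldType) (A : algType K) (I : proper_ideal2 A).

Definition alg_quot : Type := Quotient.quot I.

HB.instance Definition _ := GRing.Zmodule.on alg_quot.
HB.instance Definition _ := EqQuotient.on alg_quot.

Let pi (x : A) : alg_quot := \pi_(Quotient.quot I) x.

Let piP x y : (pi x == pi y) = (x - y \in (I : {pred A})).
Proof. by rewrite Quotient.idealrBE. Qed.

Let piE x y : x - y \in (I : {pred A}) -> pi x = pi y.
Proof. by rewrite -piP => /eqP. Qed.

Let reprP x : repr (pi x) - x \in (I : {pred A}).
Proof. by rewrite -piP /pi reprK. Qed.

Let piD x y : pi (x + y) = pi x + pi y.
Proof. exact: raddfD. Qed.

Let pi_surj (q : alg_quot) : pi (repr q) = q.
Proof. exact: reprK. Qed.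

Definition alg_quot_one : alg_quot := pi 1.
Definition alg_quot_mul (x y : alg_quot) : alg_quot := pi (repr x * repr y).
Definition alg_quot_scale (c : K) (x : alg_quot) : alg_quot :=
  pi (c *: repr x).

Let piM x y : alg_quot_mul (pi x) (pi y) = pi (x * y).
Proof.
apply: piE; set x' := repr _; set y' := repr _.
have -> : x' * y' - x * y = (x' - x) * y' + x * (y' - y).
  by rewrite mulrBl mulrBr addrA subrK.
by apply: rpredD; [exact/ideal2_mulr_subproof/reprP | exact/idealMr/reprP].
Qed.

Let piZ c x : alg_quot_scale c (pi x) = pi (c *: x).
Proof.
by apply: piE; rewrite -scalerBr -mulr_algl idealMr ?reprP.
Qed.

Fact alg_quot_mulA : associative alg_quot_mul.
Proof.
by move=> x y z; rewrite -(pi_surj x) -(pi_surj y) -(pi_surj z) !piM mulrA.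
Qed.

Fact alg_quot_mul1 : left_id alg_quot_one alg_quot_mul.
Proof. by move=> x; rewrite -(pi_surj x) piM mul1r. Qed.

Fact alg_quot_mulr1 : right_id alg_quot_one alg_quot_mul.
Proof. by move=> x; rewrite -(pi_surj x) piM mulr1. Qed.

Fact alg_quot_mulDl : left_distributive alg_quot_mul +%R.
Proof.
move=> x y z; rewrite -(pi_surj x) -(pi_surj y) -(pi_surj z).
by rewrite -piD !piM -piD mulrDl.
Qed.

Fact alg_quot_mulDr : right_distributive alg_quot_mul +%R.
Proof.
move=> x y z; rewrite -(pi_surj x) -(pi_surj y) -(pi_surj z).
by rewrite -piD !piM -piD mulrDr.
Qed.

Fact alg_quot_oner_neq0 : alg_quot_one != 0.
Proof.
have -> : 0 = pi 0 :> alg_quot by rewrite /pi raddf0.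
by rewrite piP subr0 idealr1.
Qed.

HB.instance Definition _ := GRing.Zmodule_isNzRing.Build alg_quot
  alg_quot_mulA alg_quot_mul1 alg_quot_mulr1 alg_quot_mulDl alg_quot_mulDr
  alg_quot_oner_neq0.

Fact alg_quot_scaleA a b v :
  alg_quot_scale a (alg_quot_scale b v) = alg_quot_scale (a * b) v.
Proof. by rewrite -(pi_surj v) !piZ scalerA. Qed.

Fact alg_quot_scale1 : left_id 1 alg_quot_scale.
Proof. by move=> v; rewrite -(pi_surj v) piZ scale1r. Qed.

Fact alg_quot_scaleDr : right_distributive alg_quot_scale +%R.
Proof.
move=> c u v; rewrite -(pi_surj u) -(pi_surj v).
by rewrite -piD !piZ -piD scalerDr.
Qed.

Fact alg_quot_scaleDl v : {morph alg_quot_scale^~ v : a b / a + b}.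
Proof. by move=> a b; rewrite /= -(pi_surj v) !piZ -piD scalerDl. Qed.

HB.instance Definition _ := GRing.Zmodule_isLmodule.Build K alg_quot
  alg_quot_scaleA alg_quot_scale1 alg_quot_scaleDr alg_quot_scaleDl.

Fact alg_quot_scaleAl (c : K) (u v : alg_quot) : c *: (u * v) = (c *: u) * v.
Proof.
rewrite -(pi_surj u) -(pi_surj v).
change (alg_quot_scale c (alg_quot_mul (pi (repr u)) (pi (repr v))) =
        alg_quot_mul (alg_quot_scale c (pi (repr u))) (pi (repr v))).
by rewrite piM !piZ piM scalerAl.
Qed.

HB.instance Definition _ :=
  GRing.Lmodule_isLalgebra.Build K alg_quot alg_quot_scaleAl.

Fact alg_quot_scaleAr (c : K) (u v : alg_quot) : c *: (u * v) = u * (c *: v).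
Proof.
rewrite -(pi_surj u) -(pi_surj v).
change (alg_quot_scale c (alg_quot_mul (pi (repr u)) (pi (repr v))) =
        alg_quot_mul (pi (repr u)) (alg_quot_scale c (pi (repr v)))).
by rewrite piM !piZ piM scalerAr.
Qed.

HB.instance Definition _ :=
  GRing.Lalgebra_isAlgebra.Build K alg_quot alg_quot_scaleAr.

Definition alg_pi (x : A) : alg_quot := pi x.

Fact alg_pi_is_zmod_morphism : zmod_morphism alg_pi.
Proof. by move=> x y; rewrite /alg_pi /pi raddfB. Qed.

Fact alg_pi_is_monoid_morphism : monoid_morphism alg_pi.
Proof. by split=> // x y; exact/esym/piM. Qed.

Fact alg_pi_is_scalable : scalable alg_pi.
Proof. by move=> c x; exact/esym/piZ. Qed.

HB.instance Definition _ :=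
  GRing.isZmodMorphism.Build A alg_quot alg_pi alg_pi_is_zmod_morphism.
HB.instance Definition _ :=
  GRing.isMonoidMorphism.Build A alg_quot alg_pi alg_pi_is_monoid_morphism.
HB.instance Definition _ :=
  GRing.isScalable.Build K A alg_quot *:%R alg_pi alg_pi_is_scalable.

Lemma alg_pi_eq0 x : (alg_pi x == 0) = (x \in (I : {pred A})).
Proof. by rewrite -[0](raddf0 alg_pi) [LHS]piP subr0. Qed.

Lemma alg_pi_surj (q : alg_quot) : exists x, alg_pi x = q.
Proof. by exists (repr q); exact: pi_surj. Qed.

End AlgebraQuotient.

(* Being a [vectType], a [lieAlgType K] is finite dimensional. *)
HB.mixin Record Vector_isLieAlgebra (K : fieldType) L of Vector K L := {
  lie : L -> L -> L;
  lie_linearl : forall y, linear (lie^~ y);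
  lie_linearr : forall x, linear (lie x);
  liexx : forall x, lie x x = 0;
  lie_jacobi : forall x y z,
    lie x (lie y z) + lie y (lie z x) + lie z (lie x y) = 0
}.

#[short(type="lieAlgType")]
HB.structure Definition LieAlgebra (K : fieldType) :=
  {L of Vector_isLieAlgebra K L & Vector K L}.

Section CompletelySolvable.
Variables (K : fieldType) (L : lieAlgType K).

Definition lie_ideal (I : {vspace L}) : Prop :=
  forall x y, y \in I -> lie x y \in I.

Definition completely_solvable : Prop :=
  exists c : nat -> {vspace L},
    [/\ c 0 = 0%VS, c (\dim {:L}) = fullv,
        forall i, (i < \dim {:L})%N -> (c i <= c i.+1)%VS
      & forall i, (i <= \dim {:L})%N -> lie_ideal (c i) /\ \dim (c i) = i].

End CompletelySolvable.

(* The free associative algebra on a set of noncommuting indeterminates. *)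
Section FreeAlgebra.
Variables (K : fieldType) (X : choiceType).

Definition free_alg : Type := {malg K[{fmonom X}]}.

HB.instance Definition _ := GRing.Lalgebra.on free_alg.

Fact free_alg_scaleAr (c : K) (u v : free_alg) : c *: (u * v) = u * (c *: v).
Proof.
suff h (w : {malg K[{fmonom X}]}) : c *: w = w * c%:MP.
  by rewrite -[in RHS]mul_malgC mulrA -[in RHS]h scalerAl.
rewrite malgM_def fgmulgU malgZ_def /fgscale.
by apply: eq_bigr => k _; rewrite mulm1 mulrC.
Qed.

HB.instance Definition _ :=
  GRing.Lalgebra_isAlgebra.Build K free_alg free_alg_scaleAr.

Definition free_gen (x : X) : free_alg := << fmu x >>.

End FreeAlgebra.

(* The tensor algebra of [L] is the free algebra on the elements of [L] modulo
   the linearity of the generators (first kind of relation); [U(L)] is its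
   quotient by the relations x (x) y - y (x) x - [x, y] (second kind). *)
Section EnvelopingAlgebra.
Variables (K : fieldType) (L : lieAlgType K).
Local Notation F := (free_alg K L).
Local Notation gen := (@free_gen K L).

Definition enveloping_rel (r : F) : Prop :=
  (exists c x y, r = gen (c *: x + y) - (c *: gen x + gen y)) \/
  (exists x y, r = gen x * gen y - gen y * gen x - gen (lie x y)).

Definition enveloping_ideal : {pred F} :=
  fun u => `[< forall I : {pred F}, ideal2_closed I ->
                 (forall r, enveloping_rel r -> r \in I) -> u \in I >].

Lemma enveloping_idealP u :
  reflect (forall I : {pred F}, ideal2_closed I ->
             (forall r, enveloping_rel r -> r \in I) -> u \in I)
          (u \in enveloping_ideal).
Proof. exact: asboolP. Qed.

Fact enveloping_ideal_closed : ideal2_closed enveloping_ideal.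
Proof.
split.
- by apply/enveloping_idealP => I [].
- move=> u v /enveloping_idealP uJ /enveloping_idealP vJ.
  apply/enveloping_idealP => I cI rI; case: (cI) => _ IB _ _.
  by apply: IB; [exact: uJ | exact: vJ].
- move=> a u /enveloping_idealP uJ; apply/enveloping_idealP => I cI rI.
  by case: (cI) => _ _ Il _; apply: Il; exact: uJ.
- move=> a u /enveloping_idealP uJ; apply/enveloping_idealP => I cI rI.
  by case: (cI) => _ _ _ Ir; apply: Ir; exact: uJ.
Qed.

(* The relations have zero constant term. *)
Fact enveloping_ideal_proper : 1 \notin enveloping_ideal.
Proof.
pose eps : F -> K := @mcoeff {fmonom L} K mone.
have eps_gen x : eps (gen x) = 0 by rewrite /eps mcoeffU1 fm1_eq1.
have epsB u v : eps (u - v) = eps u - eps v by exact: mcoeffB.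
have epsD u v : eps (u + v) = eps u + eps v by exact: mcoeffD.
have epsZ c u : eps (c *: u) = c * eps u by exact: mcoeffZ.
have [epsM eps1] : {morph eps : u v / u * v} * (eps 1 = 1).
  by case: (@mcoeff1g_is_multiplicative {fmonom L} K).
pose I : {pred F} := fun u => eps u == 0.
have inI u : (u \in I) = (eps u == 0) by [].
apply/negP => /enveloping_idealP /(_ I); rewrite inI eps1 oner_eq0.
case/(_ _ _)/notF.
- split.
  + by rewrite inI -(subrr 0) epsB subrr.
  + by move=> u v; rewrite !inI epsB => /eqP -> /eqP ->; rewrite subr0.
  + by move=> a u; rewrite !inI epsM => /eqP ->; rewrite mulr0.
  + by move=> a u; rewrite !inI epsM => /eqP ->; rewrite mul0r.
move=> r [[c [x [y ->]]] | [x [y ->]]]; rewrite inI.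
  by rewrite epsB epsD epsZ !eps_gen mulr0 addr0 subr0.
by rewrite !epsB !epsM !eps_gen mulr0 !subr0.
Qed.

Fact enveloping_ideal_idealr : idealr_closed enveloping_ideal.
Proof.
exact: ideal2_idealr_closed enveloping_ideal_closed enveloping_ideal_proper.
Qed.

Fact enveloping_ideal_mulr a u :
  u \in enveloping_ideal -> u * a \in enveloping_ideal.
Proof. by case: enveloping_ideal_closed => _ _ _; apply. Qed.

HB.instance Definition _ :=
  isIdealr.Build F enveloping_ideal enveloping_ideal_idealr.
HB.instance Definition _ :=
  isRightMulStable.Build F enveloping_ideal enveloping_ideal_mulr.

Definition enveloping_alg : algType K := alg_quot enveloping_ideal.

Definition enveloping_incl (x : L) : enveloping_alg :=
  alg_pi enveloping_ideal (gen x).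

Let rel_eq0 r : enveloping_rel r -> alg_pi enveloping_ideal r = 0.
Proof.
move=> hr; apply/eqP; rewrite alg_pi_eq0.
by apply/enveloping_idealP => I _; apply.
Qed.

Lemma enveloping_incl_linear : linear enveloping_incl.
Proof.
move=> c x y; apply/eqP; rewrite -subr_eq0 /enveloping_incl -linearP -raddfB.
by apply/eqP/rel_eq0; left; exists c, x, y.
Qed.

Lemma enveloping_incl_lie x y :
  enveloping_incl (lie x y) =
  enveloping_incl x * enveloping_incl y - enveloping_incl y * enveloping_incl x.
Proof.
apply/esym/eqP; rewrite -subr_eq0 /enveloping_incl -!rmorphM -!raddfB.
by apply/eqP/rel_eq0; right; exists x, y.
Qed.

End EnvelopingAlgebra.

Definition ad (R : nzRingType) (u b : R) : R := u * b - b * u.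

Definition is_eigenvalue (K : fieldType) (V : lmodType K) (phi : V -> V)
  (lambda : K) : Prop := exists2 v, v != 0 & phi v = lambda *: v.

(* Main.v *)
Require Import Defs.
From HB Require Import structures.
From mathcomp Require Import all_boot all_algebra.
From mathcomp Require Import boolp zify.
From mathcomp Require Import finmap monalg.

Set Implicit Arguments.
Unset Strict Implicit.
Unset Printing Implicit Defensive.

Import GRing.Theory.
Local Open Scope ring_scope.

(** The statement is a descent on degrees.  Suppose that an algebra carries a
    degree function with values in the natural numbers which is additive on
    products and such that a commutator [u, v] has degree strictly below
    deg u + deg v.  If [f(a), b] = lambda b with lambda, b nonzero, then a does
    not have degree 0, since then [f(a), b] would have degree below deg b.
    So deg a > 0, and modulo lower degrees [f(a), b] is f'(a) [a, b], whence
      deg b = deg [a, b] + (deg f - 1) deg a > deg [a, b].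
    As [a, b] is again an eigenvector for lambda, this can be repeated for ever,
    which is absurd ([bracket_horner_lead], [eigenvector_eq0]).

    It remains to put such a degree on a prime factor algebra A.  The
    associated graded ring of the obvious filtration by the length of words is
    not a domain in general, so the degree is built along the chain of ideals,
    in the form of good filtrations.  The tool is the set of semi-invariants,
    the simultaneous eigenvectors of the inner derivations ad g for g in the
    Lie algebra.  Complete solvability puts one in every nonzero subspace
    stable under the Lie algebra ([stable_semi]).  Primeness makes the nonzero
    ones regular, because they are normal elements.  They commute with each
    other ([semi_comm]), and they are given degree 0.

    The construction starts from the bicommutant of the semi-invariants.  It is
    commutative and stable under the Lie algebra; the annihilators of the
    powers of an element and the nilpotent elements are stable subspaces, so
    that the regularity of semi-invariants makes it a domain
    ([bicommutant_domain]), and everything in it has degree 0.  The elements of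
    a basis adapted to the chain of ideals are then added one at a time to a
    filtered subalgebra B, always after allowing division by semi-invariants
    (saturation).  Let x be the element to add.
     - If the powers of x are left independent over B, then B[x] is an Ore
       extension B[x; ad x].  Giving x a positive weight that bounds the
       degrees of the previous basis elements extends the degree ([ore_good]).
     - Otherwise let c x^m + c' x^(m-1) + ... = 0 be a relation of minimal
       degree.  The leading coefficients of such relations form a stable
       subspace, so c may be chosen semi-invariant; bracketing the relation
       with g and using its minimality shows that m c x + c' is semi-invariant
       too.  As the characteristic is zero, c x lies in B, and so does x after
       division by c ([dependent_member]). *)

(** * Commutators *)

(** Locked, since rewriting with distributivity would otherwise find the
    differences and products inside [ad]. *)
HB.lock Definition bracket (R : nzRingType) (u v : R) : R := ad u v.

Section Commutators.
Variables (K : fieldType) (A : algType K).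
Implicit Types (g s t u v w : A) (c d : K).

Lemma bracketE g u : bracket g u = ad g u.
Proof. by rewrite bracket.unlock. Qed.

Lemma bracket_lin g c u v :
  bracket g (c *: u + v) = c *: bracket g u + bracket g v.
Proof.
by rewrite !bracketE /ad mulrDr mulrDl -scalerAr -scalerAl opprD addrACA
  scalerBr.
Qed.

Lemma bracketD g u v : bracket g (u + v) = bracket g u + bracket g v.
Proof. by rewrite -[u]scale1r bracket_lin !scale1r. Qed.

Lemma bracket0 g : bracket g 0 = 0.
Proof. by rewrite !bracketE /ad mulr0 mul0r subr0. Qed.

Lemma bracketZ g c u : bracket g (c *: u) = c *: bracket g u.
Proof. by rewrite -[c *: u]addr0 bracket_lin bracket0 addr0. Qed.

Lemma bracketN g u : bracket g (- u) = - bracket g u.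
Proof. by rewrite -scaleN1r bracketZ scaleN1r. Qed.

Lemma bracket1 g : bracket g 1 = 0.
Proof. by rewrite !bracketE /ad mulr1 mul1r subrr. Qed.

Lemma bracketMr g u v : bracket g (u * v) = bracket g u * v + u * bracket g v.
Proof. by rewrite !bracketE /ad mulrBl mulrBr !mulrA addrA subrK. Qed.

Lemma bracket_sum g (I : Type) (r : seq I) (P : pred I) (E : I -> A) :
  bracket g (\sum_(i <- r | P i) E i) = \sum_(i <- r | P i) bracket g (E i).
Proof.
by apply: (big_morph (bracket g)); [exact: bracketD | exact: bracket0].
Qed.

Lemma mulr_bracket g u : u * g = g * u - bracket g u.
Proof. by rewrite !bracketE /ad opprB addrC subrK. Qed.

Lemma bracketC u v : bracket u v = - bracket v u.
Proof. by rewrite !bracketE /ad opprB. Qed.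

Lemma bracketMl u v w : bracket (u * v) w = u * bracket v w + bracket u w * v.
Proof. by rewrite bracketC bracketMr opprD addrC -mulrN -mulNr -!bracketC. Qed.

Lemma comm_bracket g u v :
  u * v = v * u -> bracket g u * v = v * bracket g u ->
    u * bracket g v = bracket g v * u.
Proof.
move=> uv guv; have := congr1 (bracket g) uv.
by rewrite !bracketMr guv [RHS]addrC => /addrI.
Qed.

End Commutators.

(** * Flags of subspaces stable under the generators *)

Section TriangularGenerators.
Variables (K : fieldType) (A : algType K) (X : seq A).
Implicit Types (g s t u v w : A) (c d : K) (l : seq A).

Fixpoint span l u : Prop :=
  if l is e :: l' then exists c, span l' (u - c *: e) else u = 0.

(** The list is read from its end: each [e] is an eigenvector of every [bracket
    g] modulo the span of the elements that follow it, so that the spans of the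
    tails form a chain of stable subspaces. *)
Fixpoint flag l : Prop :=
  if l is e :: l' then
    flag l' /\ forall g, g \in X -> exists c, span l' (bracket g e - c *: e)
  else True.

Lemma span_lin l c u v : span l u -> span l v -> span l (c *: u + v).
Proof.
elim: l u v => [|e l IH] u v /=; first by move=> -> ->; rewrite scaler0 addr0.
move=> [a ha] [b hb]; exists (c * a + b).
have -> : c *: u + v - (c * a + b) *: e = c *: (u - a *: e) + (v - b *: e).
  by rewrite scalerBr scalerDl scalerA opprD addrACA.
exact: IH.
Qed.

Lemma span0 l : span l 0.
Proof. by elim: l => [//|e l IH]; exists 0; rewrite scale0r subr0. Qed.

Lemma spanZ l c u : span l u -> span l (c *: u).
Proof.
by move=> hu; rewrite -[_ *: _]addr0; apply: span_lin => //; exact: span0.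
Qed.

Lemma spanD l u v : span l u -> span l v -> span l (u + v).
Proof. by move=> hu; rewrite -[u]scale1r; exact: span_lin. Qed.

Lemma span_cons l e u : span l u -> span (e :: l) u.
Proof. by exists 0; rewrite scale0r subr0. Qed.

Lemma span_head l e : span (e :: l) e.
Proof. by exists 1; rewrite scale1r subrr; exact: span0. Qed.

Lemma span_mem l u : u \in l -> span l u.
Proof.
elim: l => // e l IH; rewrite inE => /predU1P[->|/IH]; first exact: span_head.
exact: span_cons.
Qed.

Lemma span_catr l1 l2 u : span l2 u -> span (l1 ++ l2) u.
Proof. by move=> h; elim: l1 => //= e l IH; exact: span_cons. Qed.

Lemma span_catl l1 l2 u : span l1 u -> span (l1 ++ l2) u.
Proof.
elim: l1 u => [|e l IH] u /=; first by move->; exact: span0.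
by case=> c /IH; exists c.
Qed.

Lemma span_map (phi : A -> A) l l' u :
    (forall c v w, phi (c *: v + w) = c *: phi v + phi w) ->
    (forall e, e \in l -> span l' (phi e)) ->
  span l u -> span l' (phi u).
Proof.
move=> phi_lin; elim: l u => [|e l IH] u /= hl.
  move=> ->; have -> : phi 0 = 0 by rewrite -[X in phi X](addNr 0) -scaleN1r
    phi_lin scaleN1r addNr.
  exact: span0.
case=> c hu; have -> : u = c *: e + (u - c *: e) by rewrite addrC subrK.
rewrite phi_lin; apply: span_lin; first by apply: hl; rewrite mem_head.
by apply: IH => // e' e'l; apply: hl; rewrite inE e'l orbT.
Qed.

Lemma span_bracket l g u : flag l -> g \in X -> span l u ->
  span l (bracket g u).
Proof.
elim: l u => [|e l IH] u /=; first by move=> _ _ ->; exact: bracket0.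
case=> fl he gX [c hu]; have [d hd] := he g gX.
have -> : u = c *: e + (u - c *: e) by rewrite addrC subrK.
rewrite bracket_lin; exists (c * d).
rewrite addrAC -scalerA -scalerBr; apply: span_lin; first exact: hd.
exact: IH.
Qed.

Lemma flag_cat l1 l2 : flag l1 -> flag l2 -> flag (l1 ++ l2).
Proof.
elim: l1 => //= e l IH [fl he] fl2; split; first exact: IH.
by move=> g /he[c hc]; exists c; exact: span_catl.
Qed.

(** One row [e * m] of the list of products: the error term of [bracket g e]
    lies in the span of [l], so its products with [m] fall in the rows already
    there, and that of [bracket g x] in the part of the row already added. *)
Lemma flag_map_cat e l m M :
    {subset m <= M} -> flag m -> flag [seq w * x | w <- l, x <- M] ->
    (forall g, g \in X -> exists c, span l (bracket g e - c *: e)) ->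
  flag ([seq e * x | x <- m] ++ [seq w * x | w <- l, x <- M]).
Proof.
move=> + + fL he; elim: m => //= x m IH sub [fm hx].
have xM : x \in M by apply: sub; rewrite mem_head.
split; first by apply: IH => // y ym; apply: sub; rewrite inE ym orbT.
move=> g gX; have [c hc] := he g gX; have [d hd] := hx g gX.
exists (c + d).
have -> : bracket g (e * x) - (c + d) *: (e * x) =
          (bracket g e - c *: e) * x + e * (bracket g x - d *: x).
  by rewrite bracketMr mulrBl mulrBr -scalerAl -scalerAr scalerDl opprD addrACA.
apply: spanD.
  apply: span_catr; apply: (span_map (phi := fun w => w * x)) hc.
    by move=> a v w; rewrite mulrDl scalerAl.
  by move=> w wl; apply: span_mem; apply: allpairs_f.
apply: span_catl; apply: (span_map (phi := fun w => e * w)) hd.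
  by move=> a v w; rewrite mulrDr scalerAr.
by move=> w wl; apply: span_mem; apply: map_f.
Qed.

Lemma flag_allpairs l m : flag l -> flag m -> flag [seq e * x | e <- l, x <- m].
Proof.
move=> + fm; elim: l => //= e l IH [fl he].
by apply: flag_map_cat => //; exact: IH.
Qed.

Hypothesis flagX : flag X.
Hypothesis genX : forall Q : A -> Prop, Q 1 ->
  (forall c u v, Q u -> Q v -> Q (c *: u + v)) ->
  (forall u x, x \in X -> Q u -> Q (u * x)) -> forall u, Q u.

(** The algebra is a union of finite-dimensional triangular subspaces: flags
    are closed under concatenation and under multiplication by the flag [X] of
    the generators. *)
Lemma flag_exhaust u : exists2 l, flag l & span l u.
Proof.
move: u; apply: genX => [|c u v [l fl hu] [m fm hv]|u x xX [l fl hu]].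
- exists [:: 1]; last exact: span_head.
  by split=> // g _; exists 0; rewrite bracket1 scale0r subr0.
- exists (l ++ m); first exact: flag_cat.
  by apply: span_lin; [exact: span_catl | exact: span_catr].
- exists [seq e * y | e <- l, y <- X]; first exact: flag_allpairs.
  apply: (span_map (phi := fun w => w * x)) hu.
    by move=> a v w; rewrite mulrDl scalerAl.
  by move=> w wl; apply: span_mem; apply: allpairs_f.
Qed.

(** * Semi-invariants *)

Definition weight (chi : A -> K) s := forall g, g \in X ->
  bracket g s = chi g *: s.
Definition semi_invariant s := exists chi, weight chi s.

Lemma semiP s : (forall g, g \in X -> exists c, bracket g s = c *: s) ->
  semi_invariant s.
Proof.
move=> h; have /choice[chi hchi] g : exists c, g \in X -> bracket g s = c *: s.
  by case: (boolP (g \in X)) => [/h[c hc]|_]; [exists c | exists 0].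
by exists chi.
Qed.

Lemma weightM chi psi s t :
  weight chi s -> weight psi t -> weight (fun g => chi g + psi g) (s * t).
Proof.
by move=> hs ht g gX; rewrite bracketMr hs // ht // -scalerAl -scalerAr
  -scalerDl.
Qed.

Lemma semiM s t : semi_invariant s -> semi_invariant t ->
  semi_invariant (s * t).
Proof. by move=> [chi hs] [psi ht]; eexists; exact: weightM hs ht. Qed.

Lemma semi1 : semi_invariant 1.
Proof. by exists (fun=> 0) => g _; rewrite bracket1 scale0r. Qed.

Lemma semi0 : semi_invariant 0.
Proof. by exists (fun=> 0) => g _; rewrite bracket0 scaler0. Qed.

(** Lie's theorem is immediate here: on the shortest tail of a flag whose span
    meets [V] nontrivially, a nonzero element [v] of [V] is an eigenvector of
    each [bracket g] modulo [V] intersected with the next tail, which is 0. *)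
Lemma stable_semi (V : A -> Prop) v :
    (forall c u w, V u -> V w -> V (c *: u + w)) ->
    (forall g u, g \in X -> V u -> V (bracket g u)) ->
  V v -> v != 0 -> exists s, [/\ V s, s != 0 & semi_invariant s].
Proof.
move=> Vlin Vad Vv v0; have [l fl hv] := flag_exhaust v.
elim: l v fl hv Vv v0 => /= [|e l IH] v; first by move=> _ ->; rewrite eqxx.
case=> fl he [c hv] Vv v0.
have [[w [hw Vw w0]]|noV] := pselect (exists w, [/\ span l w, V w & w != 0]).
  exact: IH w fl hw Vw w0.
exists v; split=> //; apply: semiP => g gX; have [d hd] := he g gX.
exists d; apply/eqP; rewrite -subr_eq0; apply/negPn/negP => n0; apply: noV.
exists (bracket g v - d *: v); split=> //; last first.
  by rewrite addrC -scaleNr; apply: Vlin => //; exact: Vad.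
have -> : bracket g v - d *: v =
    c *: (bracket g e - d *: e) +
    (bracket g (v - c *: e) + (- d) *: (v - c *: e)).
  move: (v - c *: e) (subrK (c *: e) v) => w <-.
  rewrite [w + _]addrC bracket_lin scalerDr scalerBr opprD addrACA scaleNr.
  by rewrite !scalerA mulrC.
apply: span_lin; first exact: hd.
by apply: spanD; [exact: span_bracket | exact: spanZ].
Qed.

(** Normality: if [s] has weight [chi] then [s * x = (x - chi x) * s] for a
    generator [x].  The element [u'] depends on the weight only. *)
Lemma conj_weight chi u :
  exists u', forall s, weight chi s -> s * u = u' * s.
Proof.
move: u; apply: genX => [|c u v [u' hu] [v' hv]|u x xX [u' hu]].
- by exists 1 => s _; rewrite mulr1 mul1r.
- exists (c *: u' + v') => s hs.
  by rewrite mulrDr mulrDl -scalerAr -scalerAl hu // hv.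
- exists (u' * (x - (chi x)%:A)) => s hs.
  by rewrite mulrA hu // -!mulrA mulrBl mulr_algl -hs // -mulr_bracket.
Qed.

Hypothesis primeA : forall u v : A, (forall r, u * r * v = 0) -> u = 0 \/ v = 0.

Lemma semi_regl s u : semi_invariant s -> s != 0 -> s * u = 0 -> u = 0.
Proof.
move=> [chi hs] s0 su; have [r|/eqP|//] := primeA (u := s) (v := u).
  by have [r' ->] := conj_weight chi r; rewrite // -mulrA su mulr0.
by rewrite (negPf s0).
Qed.

Lemma conj_weight_left chi u :
  exists u', forall s, weight chi s -> u * s = s * u'.
Proof.
move: u; apply: genX => [|c u v [u' hu] [v' hv]|u x xX [u' hu]].
- by exists 1 => s _; rewrite mulr1 mul1r.
- exists (c *: u' + v') => s hs.
  by rewrite mulrDl mulrDr -scalerAl -scalerAr hu // hv.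
- exists (u' * (x + (chi x)%:A)) => s hs.
  have -> : u * x * s = u * s * (x + (chi x)%:A).
    by rewrite -!mulrA mulrDr mulr_algr -hs // [s * x]mulr_bracket subrK.
  by rewrite hu // mulrA.
Qed.

Lemma semi_regr s u : semi_invariant s -> s != 0 -> u * s = 0 -> u = 0.
Proof.
move=> [chi hs] s0 us; have [r|//|/eqP] := primeA (u := u) (v := s).
  by have [r' hr] := conj_weight_left chi r;
    rewrite -mulrA hr // mulrA us mul0r.
by rewrite (negPf s0).
Qed.

Lemma semiM_neq0 s t : semi_invariant s -> s != 0 -> t != 0 -> s * t != 0.
Proof. by move=> hs s0; apply: contra_neq => /(semi_regl hs s0). Qed.

Lemma semi_mulIr s u v : semi_invariant s -> s != 0 -> u * s = v * s -> u = v.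
Proof.
move=> hs s0 /eqP; rewrite -subr_eq0 -mulrBl => /eqP /(semi_regr hs s0)/eqP.
by rewrite subr_eq0 => /eqP.
Qed.

(** Combinations of words of length less than [n] in the generators. *)
Inductive word_span : nat -> A -> Prop :=
| words0 n : word_span n 0
| words1 n : word_span n.+1 1
| words_lin n c u v : word_span n u -> word_span n v -> word_span n (c *: u + v)
| wordsM n u x : x \in X -> word_span n u -> word_span n.+1 (u * x).

Lemma words_mono n u : word_span n u -> word_span n.+1 u.
Proof. by elim=> *; constructor. Qed.

Lemma words_monoW m n u : (m <= n)%N -> word_span m u -> word_span n u.
Proof. by move/subnK <-; elim: (_ - _)%N => // k IH /IH; exact: words_mono. Qed.

Lemma words_ord0 u : word_span 0 u -> u = 0.
Proof.
move e: 0%N => n h; elim: h e => // {}n c w v _ IHw _ IHv n0.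
by rewrite IHw // IHv // scaler0 addr0.
Qed.

Lemma words_exhaust u : exists n, word_span n u.
Proof.
move: u; apply: genX => [|c u v [m hu] [n hv]|u x xX [n hu]].
- by exists 1%N; constructor.
- exists (maxn m n); apply: words_lin.
    exact: words_monoW (leq_maxl m n) hu.
  exact: words_monoW (leq_maxr m n) hv.
- by exists n.+1; constructor.
Qed.

(** Substituting [x - chi x] for [x] does not change the longest words. *)
Lemma conj_words chi n u : word_span n u -> exists u',
  word_span n.-1 (u' - u) /\ forall s, weight chi s -> s * u = u' * s.
Proof.
elim=> {n u} [n|n|n c u v _ [u' [wu hu]] _ [v' [wv hv]]|n u x xX wu0 [u' [wu
  hu]]].
- by exists 0; rewrite subr0; split=> [|s _];
  [constructor | rewrite mulr0 mul0r].
- by exists 1; rewrite subrr; split=> [|s _];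
  [constructor | rewrite mulr1 mul1r].
- exists (c *: u' + v'); split=> [|s hs].
    by rewrite opprD addrACA -scalerBr; constructor.
  by rewrite mulrDr mulrDl -scalerAr -scalerAl hu // hv.
case: n => [|n] in wu0 wu *.
  by exists 0; rewrite (words_ord0 wu0) mul0r subr0; split=> [|s _];
    [constructor | rewrite mulr0 mul0r].
exists (u' * (x - (chi x)%:A)); split=> [|s hs] /=; last first.
  by rewrite mulrA hu // -!mulrA mulrBl mulr_algl -hs // -mulr_bracket.
have -> : u' * (x - (chi x)%:A) - u * x = (- chi x) *: u' + (u' - u) * x.
  by rewrite mulrBr mulr_algr mulrBl scaleNr addrCA addrA.
apply: words_lin; last by constructor.
rewrite -[u'](subrK u) -[u' - u]scale1r; apply: words_lin => //.
exact: words_mono.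
Qed.

(** Write [s * t = t' * s].  The difference [r = t' - t] has the same weight as
    [t] and is a combination of shorter words, so it commutes with [s] by
    induction.  As [t] and [r] have the same weight, moving [s] across them
    produces the same element, and for [r] this element is [s]; hence [t]
    commutes with [s]. *)
Lemma semi_comm s t : semi_invariant s -> semi_invariant t -> s * t = t * s.
Proof.
move=> [chi hs] [psi ht]; have [n wt] := words_exhaust t.
elim: n t wt ht s hs => [|n IH] t wt ht s hs.
  by rewrite (words_ord0 wt) mulr0 mul0r.
have [->|s0] := eqVneq s 0; first by rewrite mulr0 mul0r.
have [t' [wr st]] := conj_words chi wt; set r := t' - t in wr.
have rs : r * s = s * t - t * s by rewrite mulrBl st.
have hr : weight psi r.
  move=> g gX; apply: (semi_mulIr _ s0); first by exists chi.
  have : bracket g (r * s) = (chi g + psi g) *: (r * s).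
    have hst := weightM hs ht; have hts := weightM ht hs.
    rewrite rs -scaleN1r [_ + _]addrC.
    rewrite bracket_lin hst // hts // [psi g + _]addrC scalerDr !scalerA.
    by rewrite [_ * -1]mulrC.
  rewrite bracketMr hs // scalerDl addrC -scalerAr => /addrI ->.
  by rewrite scalerAl.
have [r0|r0] := eqVneq r 0.
  by apply/eqP; rewrite -subr_eq0 -rs r0 mul0r.
have sr : s * r = r * s by apply: IH.
have [s' hs'] := conj_weight psi s.
rewrite hs' //; congr (_ * t); apply: (semi_mulIr (s := r)) => //.
  by exists psi.
by rewrite -hs'.
Qed.

(** * Good filtrations *)

(** [F n u] stands for deg u < n; the subalgebra carrying the degree is the
    union of the [F n].  With the strict inequality [F 0] is 0, and [gf_dom],
    the superadditivity of the degree, also says at [m = n = 0] that there are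
    no zero divisors. *)
Record good_filtration (F : nat -> A -> Prop) : Prop := GoodFiltration {
  gf_zero : F 0%N 0;
  gf_ord0 : forall u, F 0%N u -> u = 0;
  gf_mono : forall m n u, (m <= n)%N -> F m u -> F n u;
  gf_lin : forall n c u v, F n u -> F n v -> F n (c *: u + v);
  gf_mul : forall m n u v, F m.+1 u -> F n.+1 v -> F (m + n).+1 (u * v);
  gf_comm : forall m n u v, F m.+1 u -> F n.+1 v -> F (m + n)%N (bracket u v);
  gf_dom : forall k k1 m n u v, F k u -> F k1 v -> F (m + n)%N (u * v) ->
    F m u \/ F n v;
  gf_stable : forall g n u, g \in X -> F n u -> F n (bracket g u);
  gf_semi : forall s, semi_invariant s -> F 1%N s;
  gf_conj : forall s n u, semi_invariant s -> F n u ->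
    exists2 u', F n u' & s * u = u' * s
}.

Section GoodFiltration.
Variable F : nat -> A -> Prop.
Hypothesis gF : good_filtration F.

Lemma gf0 n : F n 0.
Proof. exact (gf_mono gF (leq0n n) (gf_zero gF)). Qed.

Lemma gfZ n c u : F n u -> F n (c *: u).
Proof.
by move=> hu; rewrite -[_ *: _]addr0; apply: gf_lin => //; exact: gf0.
Qed.

Lemma gfD n u v : F n u -> F n v -> F n (u + v).
Proof. by move=> hu; rewrite -[u]scale1r; exact: gf_lin. Qed.

Lemma gfN n u : F n u -> F n (- u).
Proof. by rewrite -scaleN1r; exact: gfZ. Qed.

Lemma gfB n u v : F n u -> F n v -> F n (u - v).
Proof. by move=> hu hv; apply: gfD => //; exact: gfN. Qed.

Lemma gf_sum n (I : Type) (r : seq I) (P : pred I) (E : I -> A) :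
  (forall i, P i -> F n (E i)) -> F n (\sum_(i <- r | P i) E i).
Proof. by move=> h; apply: big_ind => //; [exact: gf0 | exact: gfD]. Qed.

Lemma gf_scalar c : F 1 c%:A.
Proof. by apply: gfZ; apply: gf_semi => //; exact: semi1. Qed.

(** The two positivity conditions save the users from treating apart the
    factors of [F 0], which are 0 whatever the degree of the other factor. *)
Lemma gfM m n k u v : F m u -> F n v ->
  ((0 < m)%N -> (0 < n)%N -> (m + n <= k.+1)%N) -> F k (u * v).
Proof.
case: m => [|m] hu; first by rewrite (gf_ord0 gF hu) mul0r => *; exact: gf0.
case: n => [|n] hv; first by rewrite (gf_ord0 gF hv) mulr0 => *; exact: gf0.
by move=> le_k; apply: gf_mono (gf_mul gF hu hv) => //; lia.
Qed.

Lemma gf_bracket m n k u v :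
  F m u -> F n v -> (m + n <= k.+2)%N -> F k (bracket u v).
Proof.
case: m => [|m] hu.
  by rewrite (gf_ord0 gF hu) bracketE /ad mul0r mulr0 subr0 => *; exact: gf0.
case: n => [|n] hv; first by rewrite (gf_ord0 gF hv) bracket0 => *; exact: gf0.
by move=> le_k; apply: gf_mono (gf_comm gF hu hv) => //; lia.
Qed.

Lemma gfX m n u : F m.+1 u -> F (n * m).+1 (u ^+ n).
Proof.
move=> hu; elim: n => [|n IH]; first exact (gf_semi gF semi1).
by rewrite exprS; apply: gfM hu IH _; lia.
Qed.

(** Conjugation by [s] preserves leading terms: [(u' - u) * s] is the commutator
    of [s] and [u], of degree below deg u, and [s] has degree 0. *)
Lemma gf_conjB s n u u' :
  semi_invariant s -> s != 0 -> F n.+1 u -> F n.+1 u' -> s * u = u' * s ->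
    F n (u' - u).
Proof.
move=> hs s0 hu hu' su; have h1 : F n ((u' - u) * s).
  have -> : (u' - u) * s = bracket s u by rewrite bracketE /ad mulrBl su.
  by apply: gf_bracket (gf_semi gF hs) hu _; lia.
rewrite -[n]addn0 in h1.
have [//|s00] := gf_dom gF (gfB hu' hu) (gf_semi gF hs) h1.
by rewrite (gf_ord0 gF s00) eqxx in s0.
Qed.

Lemma gf_exact n u : F n u -> u != 0 -> exists m, F m.+1 u /\ ~ F m u.
Proof.
move=> + u0; elim: n => [hu|n IH hu].
  by rewrite (gf_ord0 gF hu) eqxx in u0.
by have [/IH//|] := pselect (F n u); exists n.
Qed.

Definition member u := exists n, F n u.

Lemma member_lin c u v : member u -> member v -> member (c *: u + v).
Proof.
move=> [m hu] [n hv]; exists (maxn m n).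
apply: (gf_lin gF).
  by apply: (gf_mono gF) hu; exact: leq_maxl.
by apply: (gf_mono gF) hv; exact: leq_maxr.
Qed.

Lemma member_semi s : semi_invariant s -> member s.
Proof. by move=> hs; exists 1%N; exact: (gf_semi gF). Qed.

Lemma member0 : member 0.
Proof. by exists 0%N; exact: (gf_zero gF). Qed.

Lemma memberZ c u : member u -> member (c *: u).
Proof.
by move=> hu; rewrite -[_ *: _]addr0; apply: member_lin => //; exact: member0.
Qed.

Lemma memberD u v : member u -> member v -> member (u + v).
Proof. by move=> hu; rewrite -[u]scale1r; exact: member_lin. Qed.

Lemma member_sum (I : Type) (r : seq I) (P : pred I) (E : I -> A) :
  (forall i, P i -> member (E i)) -> member (\sum_(i <- r | P i) E i).
Proof.
by move=> h; apply: big_ind => //; [exact: member0 | exact: memberD].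
Qed.

Lemma memberM u v : member u -> member v -> member (u * v).
Proof.
by move=> [m hu] [n hv]; exists (m + n)%N; apply: gfM hu hv _; lia.
Qed.

Lemma member_bracket g u : g \in X -> member u -> member (bracket g u).
Proof. by move=> gX [n hu]; exists n; exact: (gf_stable gF). Qed.

End GoodFiltration.

(** * The bicommutant of the semi-invariants *)

Definition bicommutant u := forall w,
  (forall s, semi_invariant s -> s * w = w * s) -> u * w = w * u.

Definition base_filtration n u := (n = 0%N -> u = 0) /\ bicommutant u.

Lemma bicommutant_semi u s : bicommutant u -> semi_invariant s -> s * u = u * s.
Proof. by move=> hu hs; rewrite hu // => t ht; apply: semi_comm. Qed.

Lemma bicommutant_comm u v : bicommutant u -> bicommutant v -> u * v = v * u.
Proof. by move=> hu hv; rewrite hu // => s hs; exact: bicommutant_semi. Qed.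

Lemma semi_bicommutant s : semi_invariant s -> bicommutant s.
Proof. by move=> hs c hc; exact: hc. Qed.

Lemma bicommutant_lin c u v :
  bicommutant u -> bicommutant v -> bicommutant (c *: u + v).
Proof.
move=> hu hv w hw; rewrite mulrDl mulrDr -scalerAl -scalerAr hu //.
by rewrite hv.
Qed.

Lemma bicommutantM u v : bicommutant u -> bicommutant v -> bicommutant (u * v).
Proof. by move=> hu hv w hw; rewrite -mulrA hv // mulrA hu // mulrA. Qed.

Lemma bicommutant_bracket g u :
  g \in X -> bicommutant u -> bicommutant (bracket g u).
Proof.
move=> gX hu c hc; apply/esym; apply: comm_bracket; first by rewrite hu.
apply/esym/hu => s hs; apply: comm_bracket; first by rewrite hc.
have [chi /(_ g gX)->] := hs.
by rewrite -scalerAl -scalerAr hc.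
Qed.

Lemma bicommutantX n u : bicommutant u -> bicommutant (u ^+ n).
Proof.
move=> hu; elim: n => [|n IH]; last by rewrite exprS; exact: bicommutantM.
by rewrite expr0; apply: semi_bicommutant; exact: semi1.
Qed.

Lemma semiX_neq0 n s : semi_invariant s -> s != 0 -> s ^+ n != 0.
Proof.
move=> hs s0; elim: n => [|n IH]; first by rewrite expr0 oner_neq0.
by rewrite exprS semiM_neq0.
Qed.

Hypothesis charK0 : [pchar K] =i pred0.

Lemma scale_natr_eq0 n u : n.+1%:R *: u = 0 -> u = 0.
Proof.
move/eqP; rewrite scaler_eq0 => /orP[|/eqP//].
by have /pcharf0P -> := charK0.
Qed.

Lemma bicommutant_bracketX g n u : g \in X -> bicommutant u ->
  bracket g (u ^+ n.+1) = n.+1%:R *: (u ^+ n * bracket g u).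
Proof.
move=> gX hu; elim: n => [|n IH]; first by rewrite expr1 expr0 mul1r scale1r.
rewrite exprS bracketMr IH -scalerAr mulrA -exprS.
rewrite (bicommutant_comm (bicommutant_bracket gX hu) (bicommutantX _ hu)).
by rewrite -[X in X + _]scale1r -scalerDl nat1r.
Qed.

(** From [u ^+ k.+1 * y ^+ l = 0], where [y] is the derivative of [u],
    differentiation and multiplication by [y ^+ l] give
    [u ^+ k * y ^+ (l + l.+1) = 0]; the power of [u] goes down to 0. *)
Lemma nilpotent_bracket g k u : g \in X -> bicommutant u -> u ^+ k = 0 ->
  exists l : nat, bracket g u ^+ l = 0.
Proof.
move=> gX hu uk; set y := bracket g u.
have hy : bicommutant y by exact: bicommutant_bracket.
suff [l] : exists l : nat, u ^+ 0 * y ^+ l = 0 by rewrite expr0 mul1r; exists l.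
have [l] : exists l : nat, u ^+ k * y ^+ l = 0 by exists 0%N; rewrite uk mul0r.
elim: k l {uk} => [|k IH] l hl; first by exists l.
apply: (IH (l + l.+1)%N); apply: (@scale_natr_eq0 k).
have := congr1 (fun w => y ^+ l * bracket g w) hl.
rewrite /= bracket0 mulr0 bracketMr bicommutant_bracketX // mulrDr => <-.
have comm m n : y ^+ m * u ^+ n = u ^+ n * y ^+ m.
  by apply: bicommutant_comm; apply: bicommutantX.
rewrite [X in _ + X](_ : _ = 0); last first.
  rewrite mulrA comm hl mul0r //.
by rewrite addr0 -scalerAl -scalerAr !mulrA comm -!mulrA exprD exprS.
Qed.

(** If [u * v = 0] with [v] nonzero, the elements killed by a power of [u] form
    a nonzero stable subspace.  It contains a semi-invariant, which is regular,
    so [u] is nilpotent.  If [u] were nonzero, the nilpotent elements would in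
    turn form a nonzero stable subspace and contain a regular element. *)
Lemma bicommutant_domain u v :
  bicommutant u -> u * v = 0 -> u = 0 \/ v = 0.
Proof.
move=> hu uv; have [->|v0] := eqVneq v 0; [by right | left].
pose killed w := exists k, u ^+ k * w = 0.
have [||||s [[k us] s0 hs]] := @stable_semi killed v.
- move=> c w1 w2 [k h1] [l h2]; exists (k + l)%N.
  rewrite mulrDr -scalerAr [in X in X + _]addnC !exprD -!mulrA h1 h2.
  by rewrite !mulr0 scaler0 addr0.
- move=> g w gX [k hk]; exists (k + k)%N; rewrite exprD -mulrA.
  have := congr1 (fun z => u ^+ k * bracket g z) hk.
  rewrite /= bracket0 mulr0 bracketMr mulrDr => <-.
  rewrite [X in X + _](_ : _ = 0) ?add0r // mulrA.
  rewrite (bicommutant_comm (bicommutantX _ hu)); last first.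
    by apply: bicommutant_bracket => //; exact: bicommutantX.
  by rewrite -mulrA hk mulr0.
- by exists 1%N.
- exact: v0.
have {us} uk : u ^+ k = 0 by exact: semi_regr us.
apply/eqP/negPn/negP => u0.
pose nil w := bicommutant w /\ exists k, w ^+ k = 0.
have [||||t [[_ [l tl]] t0 ht]] := @stable_semi nil u.
- move=> c w1 w2 [b1 [m h1]] [b2 [n h2]]; split; first exact: bicommutant_lin.
  exists (m + n)%N; rewrite exprDn_comm; last first.
    by rewrite /GRing.comm -scalerAl -scalerAr (bicommutant_comm b1).
  apply: big1 => i _; have [le_ni|lt_in] := leqP n i.
    have -> : w2 ^+ i = 0 by rewrite -(subnK le_ni) exprD h2 mulr0.
    by rewrite mulr0 mul0rn.
  have le_m : (m <= m + n - i)%N by lia.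
  have -> : (c *: w1) ^+ (m + n - i) = 0.
    by rewrite exprZn -(subnK le_m) [w1 ^+ _]exprD h1 mulr0 scaler0.
  by rewrite mul0r mul0rn.
- move=> g w gX [hw [m hm]]; split; first exact: bicommutant_bracket.
  exact: nilpotent_bracket hm.
- by split=> //; exists k.
- by [].
by have := semiX_neq0 l ht t0; rewrite tl eqxx.
Qed.

Lemma base_filtration_good : good_filtration base_filtration.
Proof.
have semi0b : bicommutant 0 by apply: semi_bicommutant; exact: semi0.
split.
- by [].
- by move=> u [->].
- by move=> m n u le_mn [h hu]; split=> // n0; apply: h; lia.
- move=> n c u v [u0 hu] [v0 hv]; split; last exact: bicommutant_lin.
  by move=> n0; rewrite u0 // v0 // scaler0 addr0.
- by move=> m n u v [_ hu] [_ hv]; split=> //; exact: bicommutantM.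
- move=> m n u v [_ hu] [_ hv].
  by rewrite bracketE /ad (bicommutant_comm hu hv) subrr; split.
- move=> k l m n u v [_ hu] [_ hv] [uv _].
  case: m uv => [|m] uv; last by left.
  case: n uv => [|n] uv; last by right.
  by have [->|->] := bicommutant_domain hu (uv erefl); [left | right].
- move=> g n u gX [u0 hu]; split; last exact: bicommutant_bracket.
  by move=> /u0->; rewrite bracket0.
- by move=> s hs; split=> //; exact: semi_bicommutant.
- by move=> s n u hs hu; exists u => //; apply: bicommutant_semi => //;
  case: hu.
Qed.

(** * Division by semi-invariants *)

Definition saturation (F : nat -> A -> Prop) n u :=
  exists s, [/\ semi_invariant s, s != 0 & F n (s * u)].

Definition saturated (F : nat -> A -> Prop) :=
  forall n s u, semi_invariant s -> s != 0 -> F n (s * u) -> F n u.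

Section Saturation.
Variable F : nat -> A -> Prop.
Hypothesis gF : good_filtration F.

Lemma sub_saturation n u : F n u -> saturation F n u.
Proof.
by move=> hu; exists 1; rewrite mul1r oner_neq0; split=> //; exact: semi1.
Qed.

Lemma saturation_saturated : saturated (saturation F).
Proof.
move=> n s u hs s0 [t [ht t0 hu]]; exists (t * s).
by rewrite -mulrA; split=> //; [exact: semiM | exact: semiM_neq0].
Qed.

Lemma gf_semiM s n u : semi_invariant s -> F n u -> F n (s * u).
Proof. by move=> hs hu; apply: (gfM gF) (gf_semi gF hs) hu _. Qed.

(** If [p = s * u] and [q = t * v] are in the filtration, then
    [t * s * (u * v) = p' * q], where [t * p = p' * t] and [p'] has the same
    leading part as [p]. *)
Lemma saturation_good : good_filtration (saturation F).
Proof.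
split.
- exact/sub_saturation/(gf_zero gF).
- by move=> u [s [hs s0 /(gf_ord0 gF)]]; exact: semi_regl.
- move=> m n u le_mn [s [hs s0 hu]]; exists s; split=> //.
  exact (gf_mono gF le_mn hu).
- move=> n c u v [s [hs s0 hu]] [t [ht t0 hv]]; exists (t * s).
  split; [exact: semiM | exact: semiM_neq0 |].
  rewrite mulrDr -scalerAr; apply: (gf_lin gF).
    by rewrite -mulrA; apply: gf_semiM.
  by rewrite (semi_comm ht hs) -mulrA; apply: gf_semiM.
- move=> m n u v [s [hs s0 hu]] [t [ht t0 hv]].
  have [p hp tp] := gf_conj gF ht hu.
  exists (t * s); split; [exact: semiM | exact: semiM_neq0 |].
  rewrite mulrA -[t * s * u]mulrA tp -mulrA.
  exact (gf_mul gF hp hv).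
- move=> m n u v [s [hs s0 hu]] [t [ht t0 hv]].
  have [p hp tp] := gf_conj gF ht hu; have [q hq sq] := gf_conj gF hs hv.
  exists (t * s); split; [exact: semiM | exact: semiM_neq0 |].
  have -> : t * s * bracket u v =
      (p - s * u) * (t * v) + bracket (s * u) (t * v) - (q - t * v) * (s * u).
    rewrite !bracketE /ad mulrBr {2}(semi_comm ht hs).
    have -> : t * s * (u * v) = p * (t * v).
      by rewrite mulrA -[t * s * u]mulrA tp -mulrA.
    have -> : s * t * (v * u) = q * (s * u).
      by rewrite mulrA -[s * t * v]mulrA sq -mulrA.
    by rewrite !mulrBl addrA subrK opprB addrA subrK.
  have hpu : F m (p - s * u) by apply: (gf_conjB gF ht t0 hu hp).
  have hqv : F n (q - t * v) by apply: (gf_conjB gF hs s0 hv hq).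
  apply: (gfB gF); last by apply: (gfM gF) hqv hu _; lia.
  apply: (gfD gF); first by apply: (gfM gF) hpu hv _; lia.
  by apply: (gf_bracket gF) hu hv _; lia.
- move=> k l m n u v [s [hs s0 hu]] [t [ht t0 hv]] [r [hr r0 huv]].
  have [p hp tp] := gf_conj gF ht hu.
  have hpq : F (0 + (m + n)) (r * (p * (t * v))).
    have -> : p * (t * v) = t * s * (u * v) by rewrite mulrA -tp !mulrA.
    rewrite mulrA (semi_comm hr (semiM ht hs)) -!mulrA.
    by apply: gf_semiM => //; apply: gf_semiM.
  have hpv : F (k + l).+1 (p * (t * v)) by apply: (gfM gF) hp hv _; lia.
  have [r00|{}hpq] := gf_dom gF (gf_semi gF hr) hpv hpq.
    by rewrite (gf_ord0 gF r00) eqxx in r0.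
  have [{}hp|{}hv] := gf_dom gF hp hv hpq; [left | by right; exists t].
  exists (t * s); split; [exact: semiM | exact: semiM_neq0 |].
  by rewrite -mulrA tp; apply: (gfM gF) hp (gf_semi gF ht) _; lia.
- move=> g n u gX [s [hs s0 hu]]; exists s; split=> //.
  have := gf_stable gF gX hu; rewrite bracketMr; have [chi /(_ g gX)->] := hs.
  rewrite -scalerAl => /(gfD gF (gfZ gF (- chi g) hu)).
  by rewrite scaleNr addKr.
- by move=> s hs; apply/sub_saturation/(gf_semi gF).
- move=> t n u ht [s [hs s0 hu]].
  have [->|t0] := eqVneq t 0.
    by exists 0; [exact/sub_saturation/(gf0 gF) | rewrite !mul0r].
  have [p hp tp] := gf_conj gF ht hu.
  have [chi /= tchi] := ht; have [u' /(_ t tchi) tu] := conj_weight chi u.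
  exists u' => //; exists s; split=> //; suff -> : s * u' = p by [].
  by apply: (semi_mulIr ht t0); rewrite -mulrA -tu -tp !mulrA [s * t]semi_comm.
Qed.

End Saturation.

(** * Adjoining an independent generator *)

Lemma last_failure (P : nat -> Prop) k m :
    (forall i j, (i <= j)%N -> P i -> P j) -> P k -> ~ P m ->
  exists M, [/\ (m <= M)%N, P M.+1 & ~ P M].
Proof.
move=> Pmono + nPm; elim: k => [/(Pmono _ _ (leq0n m))//|k IH Pk].
have [/IH//|nPk] := pselect (P k); exists k; split=> //.
by rewrite leqNgt; apply/negP => lt_km; apply: nPm; apply: Pmono Pk.
Qed.

Lemma horner_mulXn (R : nzRingType) (p : {poly R}) y n :
  (p * 'X^n).[y] = p.[y] * y ^+ n.
Proof.
elim: n => [|n IH]; first by rewrite !expr0 !mulr1.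
by rewrite !exprSr !mulrA hornerMX IH.
Qed.

Section OreExtension.
Variables (F : nat -> A -> Prop) (x : A) (w : nat).
Hypothesis gF : good_filtration F.
Hypothesis xX : x \in X.
Hypothesis w_gt0 : (0 < w)%N.
Hypothesis x_tri : forall g, g \in X -> exists c, F w.+1 (bracket g x - c *: x).
Hypothesis x_free : forall p : {poly A},
  (forall k, exists n, F n p`_k) -> p.[x] = 0 -> p = 0.

(** The polynomials only record left coefficients; their product in [{poly A}]
    is not the one of the Ore extension, but agrees with it on leading parts. *)
Definition oreF n u :=
  exists2 p : {poly A}, forall k, F (n - k * w)%N p`_k & u = p.[x].

Lemma ore_ind n (Q : A -> Prop) :
    Q 0 -> (forall u v, Q u -> Q v -> Q (u + v)) ->
    (forall k b, F (n - k * w)%N b -> Q (b * x ^+ k)) ->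
  forall u, oreF n u -> Q u.
Proof.
move=> Q0 QD Qt u [p hp ->]; rewrite horner_coef.
by apply: big_ind => // i _; exact: Qt.
Qed.

Lemma ore_term n k b : F (n - k * w)%N b -> oreF n (b * x ^+ k).
Proof.
move=> hb; exists (b%:P * 'X^k); last by rewrite hornerCM hornerXn.
move=> i; rewrite coefCM coefXn; case: eqP => [->|_]; first by rewrite mulr1.
by rewrite mulr0; exact: (gf0 gF).
Qed.

Lemma ore_lin n c u v : oreF n u -> oreF n v -> oreF n (c *: u + v).
Proof.
move=> [p hp ->] [q hq ->]; exists (c%:A%:P * p + q).
  move=> k; rewrite coefD coefCM mulr_algl.
  by apply: (gf_lin gF).
by rewrite hornerD hornerCM mulr_algl.
Qed.

Lemma ore0 n : oreF n 0.
Proof. by rewrite -(mul0r (x ^+ 0)); apply: ore_term; exact: (gf0 gF). Qed.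

Lemma oreZ n c u : oreF n u -> oreF n (c *: u).
Proof.
by move=> hu; rewrite -[_ *: _]addr0; apply: ore_lin => //; exact: ore0.
Qed.

Lemma oreD n u v : oreF n u -> oreF n v -> oreF n (u + v).
Proof. by move=> hu; rewrite -[u]scale1r; exact: ore_lin. Qed.

Lemma oreN n u : oreF n u -> oreF n (- u).
Proof. by rewrite -scaleN1r; exact: oreZ. Qed.

Lemma ore_mono m n u : (m <= n)%N -> oreF m u -> oreF n u.
Proof.
move=> le_mn [p hp ->]; exists p => // k.
by apply: (gf_mono gF) (hp k); rewrite leq_sub2r.
Qed.

Lemma ore_ord0 u : oreF 0 u -> u = 0.
Proof.
move=> [p hp ->]; have -> : p = 0; last by rewrite horner0.
by apply/polyP => k; rewrite coef0; apply: (gf_ord0 gF); have := hp k;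
  rewrite sub0n.
Qed.

Lemma ore_sub n u : F n u -> oreF n u.
Proof.
by move=> hu; rewrite -[u]mulr1; apply: (@ore_term n 0); rewrite subn0.
Qed.

Lemma ore_X k : oreF (k * w).+1 (x ^+ k).
Proof.
rewrite -[x ^+ k]mul1r; apply: ore_term; rewrite subSnn.
by apply: (gf_semi gF); exact: semi1.
Qed.

Lemma ore_mulXn n k u : oreF n u -> oreF (n + k * w) (u * x ^+ k).
Proof.
move: u; apply: ore_ind => [|u v|j b hb]; first by rewrite mul0r; exact: ore0.
  by rewrite mulrDl; exact: oreD.
rewrite -mulrA -exprD; apply: ore_term.
by rewrite mulnDl subnDr.
Qed.

Lemma ore_Xmul n u : oreF n u -> oreF (n + w) (x * u).
Proof.
move: u; apply: ore_ind => [|u v|k b hb]; first by rewrite mulr0; exact: ore0.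
  by rewrite mulrDr; exact: oreD.
have -> : x * (b * x ^+ k) = b * x ^+ k.+1 + bracket x b * x ^+ k.
  by rewrite exprS !mulrA -mulrDl [b * x]mulr_bracket subrK.
apply: oreD; apply: ore_term; first by rewrite mulSn addnC subnDl.
by apply: (gf_mono gF) (gf_stable gF xX hb); lia.
Qed.

Lemma ore_Xnmul n k u : oreF n u -> oreF (n + k * w) (x ^+ k * u).
Proof.
move=> hu; elim: k => [|k IH]; first by rewrite expr0 mul1r addn0.
by rewrite exprS -mulrA mulSn addnCA addnC; exact: ore_Xmul.
Qed.

Lemma ore_coefmul a n b u : F a b -> oreF n u -> oreF (a.-1 + n) (b * u).
Proof.
move=> hb; move: u; apply: ore_ind => [|u v|k b' hb'].
- by rewrite mulr0; exact: ore0.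
- by rewrite mulrDr; exact: oreD.
by rewrite mulrA; apply: ore_term; apply: (gfM gF) hb hb' _; lia.
Qed.

(** When [n <= k * w] the hypothesis forces [b = 0]; otherwise [b] has degree
    at most [n.-1 - k * w]. *)
Lemma ore_coefmul_term n k b m u : F (n - k * w) b -> oreF m u ->
  oreF (n.-1 - k * w + m) (b * u).
Proof.
move=> hb hu; have [lt_kn|le_nk] := ltnP (k * w) n; last first.
  rewrite (eqP (_ : n - k * w == 0)%N) ?subn_eq0 // in hb.
  by rewrite (gf_ord0 gF hb) mul0r; exact: ore0.
by apply: ore_mono (ore_coefmul hb hu); lia.
Qed.

Lemma ore_mul m n u v : oreF m.+1 u -> oreF n.+1 v -> oreF (m + n).+1 (u * v).
Proof.
move=> + hv; move: u; apply: ore_ind => [|u1 u2|k b hb].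
- by rewrite mul0r; exact: ore0.
- by rewrite mulrDl; exact: oreD.
have [lt_km|le_mk] := leqP (k * w) m; last first.
  rewrite (eqP (_ : m.+1 - k * w == 0)%N) ?subn_eq0 // in hb.
  by rewrite (gf_ord0 gF hb) !mul0r; exact: ore0.
rewrite -mulrA; apply: ore_mono (ore_coefmul_term hb (ore_Xnmul k hv)).
lia.
Qed.

(** The weight of [x] is positive while [bracket x] does not raise the degree
    of coefficients, so a commutator with [x] loses degree. *)
Lemma ore_bracket_coefX m k b : F m.+1 b ->
  oreF (m + k * w) (bracket b (x ^+ k)).
Proof.
move=> hb; elim: k => [|k IH]; first by rewrite expr0 bracket1; exact: ore0.
rewrite exprS bracketMr; apply: oreD.
  apply: ore_term; rewrite bracketC; apply: (gfN gF).
  by apply: (gf_mono gF) (gf_stable gF xX hb); lia.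
by apply: ore_mono (ore_Xmul IH); lia.
Qed.

Lemma ore_bracket_coef m n b v :
  F m.+1 b -> oreF n.+1 v -> oreF (m + n) (bracket b v).
Proof.
move=> hb; move: v; apply: ore_ind => [|u v|k b' hb'].
- by rewrite bracket0; exact: ore0.
- by rewrite bracketD; exact: oreD.
have [le_kn|lt_nk] := leqP (k * w) n; last first.
  rewrite (eqP (_ : n.+1 - k * w == 0)%N) ?subn_eq0 // in hb'.
  by rewrite (gf_ord0 gF hb') mul0r bracket0; exact: ore0.
rewrite bracketMr; apply: oreD.
  by apply: ore_term; apply: (gf_bracket gF) hb hb' _; lia.
apply: ore_mono (ore_coefmul_term hb' (ore_bracket_coefX k hb)); lia.
Qed.

Lemma ore_bracketX n k v : oreF n.+1 v -> oreF (k * w + n) (bracket (x ^+ k) v).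
Proof.
move=> hv; have hxv : oreF n.+1 (bracket x v).
  move: v hv; apply: ore_ind => [|u v|j b hb].
  - by rewrite bracket0; exact: ore0.
  - by rewrite bracketD; exact: oreD.
  have -> : bracket x (b * x ^+ j) = bracket x b * x ^+ j.
    by rewrite bracketMr [bracket x (x ^+ j)]bracketE /ad -exprS -exprSr subrr
      mulr0 addr0.
  by apply: ore_term; exact: (gf_stable gF).
elim: k => [|k IH].
  by rewrite expr0 bracketC bracket1 oppr0; exact: ore0.
rewrite exprS bracketMl; apply: oreD; first by apply: ore_mono (ore_Xmul IH);
  lia.
by apply: ore_mono (ore_mul hxv (ore_X k)); lia.
Qed.

Lemma ore_comm m n u v : oreF m.+1 u -> oreF n.+1 v ->
  oreF (m + n) (bracket u v).
Proof.
move=> + hv; move: u; apply: ore_ind => [|u1 u2|k b hb].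
- by rewrite bracketC bracket0 oppr0; exact: ore0.
- by rewrite ![bracket _ v]bracketC bracketD opprD; exact: oreD.
have [le_km|lt_mk] := leqP (k * w) m; last first.
  rewrite (eqP (_ : m.+1 - k * w == 0)%N) ?subn_eq0 // in hb.
  by rewrite (gf_ord0 gF hb) mul0r bracketC bracket0 oppr0; exact: ore0.
rewrite bracketMl; apply: oreD.
  by apply: ore_mono (ore_coefmul_term hb (ore_bracketX k hv)); lia.
have {}hb : F (m - k * w).+1 b by rewrite -subSn.
by apply: ore_mono (ore_mulXn k (ore_bracket_coef hb hv)); lia.
Qed.

Lemma ore_bracket g n u : g \in X -> oreF n u -> oreF n (bracket g u).
Proof.
move=> gX; have hX k : oreF (k * w).+1 (bracket g (x ^+ k)).
  elim: k => [|k IH]; first by rewrite expr0 bracket1; exact: ore0.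
  rewrite exprS bracketMr mulSn; apply: oreD; last by rewrite addnC -addSn;
    exact: ore_Xmul.
  apply: ore_mul (ore_X k); have [c hc] := x_tri gX.
  rewrite -[bracket g x](subrK (c *: x)); apply: oreD; first exact: ore_sub.
  by apply: oreZ; have := ore_X 1; rewrite mul1n expr1.
move: u; apply: ore_ind => [|u v|k b hb].
- by rewrite bracket0; exact: ore0.
- by rewrite bracketD; exact: oreD.
have [lt_kn|le_nk] := ltnP (k * w) n; last first.
  rewrite (eqP (_ : n - k * w == 0)%N) ?subn_eq0 // in hb.
  by rewrite (gf_ord0 gF hb) mul0r bracket0; exact: ore0.
rewrite bracketMr; apply: oreD; first by apply: ore_term; exact: (gf_stable gF).
by apply: ore_mono (ore_coefmul_term hb (hX k)); lia.
Qed.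

Lemma ore_conj s n u :
  semi_invariant s -> oreF n u -> exists2 u', oreF n u' & s * u = u' * s.
Proof.
move=> hs; have [chi /(_ x xX) xs] := hs.
pose y := x - (chi x)%:A.
have sy k : s * x ^+ k = y ^+ k * s.
  elim: k => [|k IH]; first by rewrite !expr0 mulr1 mul1r.
  rewrite exprSr mulrA IH exprSr -!mulrA; congr (_ * _).
  by rewrite /y mulrBl mulr_algl -xs -mulr_bracket.
have hy k : oreF (k * w).+1 (y ^+ k).
  elim: k => [|k IH]; first by apply: ore_sub; apply: (gf_semi gF);
    exact: semi1.
  rewrite exprS mulSn; apply: ore_mul IH; apply: oreD.
    by have := ore_X 1; rewrite mul1n expr1.
  apply: oreN; apply: ore_sub; apply: (gf_mono gF) (gf_scalar gF _); lia.
move: u; apply: ore_ind => [|u v [u' hu su] [v' hv sv]|k b hb].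
- by exists 0; [exact: ore0 | rewrite mulr0 mul0r].
- by exists (u' + v'); [exact: oreD | rewrite mulrDr mulrDl su sv].
have [lt_kn|le_nk] := ltnP (k * w) n; last first.
  rewrite (eqP (_ : n - k * w == 0)%N) ?subn_eq0 // in hb.
  by exists 0; [exact: ore0 | rewrite (gf_ord0 gF hb) !(mul0r, mulr0)].
have [b' hb' sb] := gf_conj gF hs hb; exists (b' * y ^+ k).
  by apply: ore_mono (ore_coefmul_term hb' (hy k)); lia.
by rewrite mulrA sb -!mulrA sy.
Qed.

(** When [u] has degree exactly [M], [k] is the highest power of [x] that
    contributes to its leading part. *)
Lemma ore_lead M u : oreF M.+1 u -> ~ oreF M u ->
  exists p : {poly A}, exists k, [/\ forall i, F (M.+1 - i * w) p`_i, u = p.[x],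
    ~ F (M - k * w) p`_k, (k * w <= M)%N &
    forall i, (k < i)%N -> F (M - i * w) p`_i].
Proof.
move=> [p hp ->] nM; exists p.
pose bad i := ~~ `[< F (M - i * w) p`_i >].
have [i0 bad0] : exists i, bad i.
  apply: contrapT => noi; apply: nM; exists p => // i.
  by apply: contrapT => /asboolPn nF; apply: noi; exists i.
have ub i : bad i -> (i <= size p)%N.
  move=> /asboolPn nF; rewrite leqNgt; apply/negP => lt_pi; apply: nF.
  by rewrite (nth_default _ (ltnW lt_pi)); exact (gf0 gF _).
case: (ex_maxnP (ex_intro _ i0 bad0) ub) => k /asboolPn badk maxk.
exists k; split=> //.
  rewrite leqNgt; apply/negP => lt_Mk; apply: badk.
  have -> : (M - k * w)%N = (M.+1 - k * w)%N by lia.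
  exact: hp.
move=> i lt_ki; apply: contrapT => /asboolPn/maxk.
by rewrite leqNgt lt_ki.
Qed.

(** Let [u = p.[x]] and [v = q.[x]] have degrees exactly [M] and [N].  Up to
    commutators, of lower degree, [u * v] is [(p * q).[x]].  If [k] and [j] are
    the highest powers contributing to the leading parts of [p] and [q], all
    products contributing to the coefficient of [p * q] of index [k + j] are of
    lower degree, except for [p`_k * q`_j], which is not. *)
Lemma ore_dom k1 k2 m n u v : oreF k1 u -> oreF k2 v -> oreF (m + n) (u * v) ->
  oreF m u \/ oreF n v.
Proof.
move=> hu hv huv; apply: contrapT => /not_orP[nu nv].
have mono u0 i j : (i <= j)%N -> oreF i u0 -> oreF j u0 by exact: ore_mono.
have [M [le_mM {}hu {}nu]] := last_failure (mono u) hu nu.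
have [N [le_nN {}hv {}nv]] := last_failure (mono v) hv nv.
have {}huv : oreF (M + N) (u * v) by apply: ore_mono huv; lia.
have [p [k [hp up bk kM maxk]]] := ore_lead hu nu.
have [q [j [hq vq bj jN maxj]]] := ore_lead hv nv.
have e : u * v = (p * q).[x] + \sum_(i < size p) p`_i * bracket (x ^+ i) v.
  rewrite [in LHS]up horner_coef mulr_suml.
  have -> : p * q = \sum_(i < size p) (p`_i)%:P * q * 'X^i.
    rewrite -[in LHS](coefK p) poly_def mulr_suml; apply: eq_bigr => i _.
    by rewrite -mul_polyC -!mulrA commr_polyXn.
  rewrite horner_sum -big_split /=; apply: eq_bigr => i _.
  rewrite horner_mulXn hornerCM -vq -!mulrA -mulrDr; congr (_ * _).
  by rewrite bracketE /ad addrC subrK.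
have [r hr pqr] : oreF (M + N) (p * q).[x].
  have -> : (p * q).[x] = u * v - \sum_(i < size p) p`_i * bracket (x ^+ i) v.
    by rewrite e addrK.
  apply: oreD => //; apply: oreN.
  apply: big_ind => [||i _]; [exact: ore0 | exact: oreD |].
  have [le_iM|lt_Mi] := leqP (i * w) M; last first.
    have := hp i; rewrite (eqP (_ : M.+1 - i * w == 0)%N) ?subn_eq0 // => pi0.
    by rewrite (gf_ord0 gF pi0) mul0r; exact: ore0.
  by apply: ore_mono (ore_coefmul_term (hp i) (ore_bracketX i hv)); lia.
have rpq : p * q = r.
  apply/eqP; rewrite -subr_eq0; apply/eqP/x_free => [i|].
    exists (M + N).+1; rewrite coefB coefM; apply: (gfB gF).
      apply: (gf_sum gF) => i' _; apply: (gfM gF) (hp _) (hq _) _; lia.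
    by apply: (gf_mono gF) (hr i); lia.
  by rewrite hornerD hornerN pqr subrr.
have := hr (k + j)%N; rewrite -rpq coefM.
have lt_k : (k < (k + j).+1)%N by lia.
rewrite (bigD1 (Ordinal lt_k)) //= addKn => hkj.
have {hkj} : F (M - k * w + (N - j * w)) (p`_k * q`_j).
  rewrite -[_ * _](addrK (\sum_(i < (k + j).+1 | i != Ordinal lt_k) p`_i *
    q`_(k + j - i))).
  have -> : (M - k * w + (N - j * w) = M + N - (k + j) * w)%N.
    by rewrite mulnDl; lia.
  apply: (gfB gF) hkj _; apply: (gf_sum gF) => i ik.
  have {}ik : (i : nat) <> k by move=> ik'; case/eqP: ik; apply: val_inj.
  have := ltn_ord i; rewrite ltnS => le_i.
  have [lt_ik|le_ki] := ltnP i k.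
    apply: (gfM gF) (hp i) (maxj (k + j - i)%N _) _; first by lia.
    by have := leq_mul (ltnW lt_ik) (leqnn w); rewrite mulnBl !mulnDl; lia.
  apply: (gfM gF) (maxk i _) (hq (k + j - i)%N) _; first by lia.
  by have := leq_mul le_i (leqnn w); rewrite mulnBl !mulnDl; lia.
by case/(gf_dom gF (hp k) (hq j)).
Qed.

Lemma ore_good : good_filtration oreF.
Proof.
split.
- exact: ore0.
- exact: ore_ord0.
- exact: ore_mono.
- exact: ore_lin.
- exact: ore_mul.
- exact: ore_comm.
- exact: ore_dom.
- exact: ore_bracket.
- by move=> s hs; apply: ore_sub; exact: (gf_semi gF).
- exact: ore_conj.
Qed.

End OreExtension.

(** * Adjoining a dependent generator *)

Section DependentGenerator.
Variables (F : nat -> A -> Prop) (x : A).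
Hypothesis gF : good_filtration F.
Hypothesis satF : saturated F.
Hypothesis xX : x \in X.

Hypothesis x_tri : forall g, g \in X -> exists c, member F (bracket g x - c *:
  x).

Definition relation (p : {poly A}) := (forall k, member F p`_k) /\ p.[x] = 0.

Lemma relation_lin c p q :
  relation p -> relation q -> relation (c%:A%:P * p + q).
Proof.
move=> [hp p0] [hq q0]; split=> [k|].
  by rewrite coefD coefCM mulr_algl; exact: (member_lin gF).
by rewrite hornerD hornerCM p0 q0 mulr0 addr0.
Qed.

(** [bracket g (x ^+ k)] as a polynomial in [x] with left coefficients, when
    [bracket g x = c *: x + v].  The last summand comes from moving [x] to the
    right of the coefficients. *)
Fixpoint bracketX_poly c v k : {poly A} :=
  if k is k'.+1 then
    c%:A%:P * 'X^k + v%:P * 'X^k' + bracketX_poly c v k' * 'X +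
    \poly_(i < size (bracketX_poly c v k')) bracket x (bracketX_poly c v k')`_i
  else 0.

Lemma coef_bracketXS c v k i : (bracketX_poly c v k.+1)`_i =
  (if i == k.+1 then c%:A else 0) + (if i == k then v else 0) +
  (if i is i'.+1 then (bracketX_poly c v k)`_i' else 0) +
  bracket x (bracketX_poly c v k)`_i.
Proof.
rewrite [bracketX_poly _ _ _]/= !coefD !coefCM !coefXn coefMX coef_poly.
congr (_ + _ + _ + _).
- by case: eqP => _; rewrite (mulr1, mulr0).
- by case: eqP => _; rewrite (mulr1, mulr0).
- by case: i.
- by case: ltnP => // le_i; rewrite nth_default // bracket0.
Qed.

Lemma bracketX_high c v k i : (k < i)%N -> (bracketX_poly c v k)`_i = 0.
Proof.
elim: k i => [|k IH] i lt_ki; first by rewrite coef0.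
rewrite coef_bracketXS IH ?bracket0; last by lia.
case: i lt_ki => // i lt_ki; rewrite IH //.
by case: eqP => [|_]; case: eqP => [|_]; rewrite ?addr0 //; lia.
Qed.

Lemma bracketX_top c v k : (bracketX_poly c v k)`_k = (k%:R * c)%:A.
Proof.
elim: k => [|k IH]; first by rewrite coef0 mul0r scale0r.
rewrite coef_bracketXS eqxx [(bracketX_poly c v k)`_k.+1]bracketX_high //
  bracket0 addr0 IH.
case: eqP => [|_]; first lia.
by rewrite addr0 -scalerDl -nat1r mulrDl mul1r.
Qed.

Lemma bracketX_subtop c v k : (bracketX_poly c v k.+1)`_k = k.+1%:R *: v.
Proof.
elim: k => [|k IH].
  by rewrite coef_bracketXS /= coef0 bracket0 !addr0 add0r scale1r.
rewrite coef_bracketXS IH bracketX_top bracketZ bracket1 scaler0 addr0 eqxx.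
case: eqP => [|_]; first lia.
by rewrite add0r -[in LHS](scale1r v) scalerA mulr1 -scalerDl nat1r.
Qed.

Lemma bracketX_member c v k i : member F v -> member F (bracketX_poly c v k)`_i.
Proof.
move=> hv; elim: k i => [|k IH] i; first by rewrite coef0; exact: (member0 gF).
rewrite coef_bracketXS; apply: (memberD gF); last exact: (member_bracket gF).
apply: (memberD gF); last by case: i => // *; exact: (member0 gF).
apply: (memberD gF); case: eqP => // _; try exact: (member0 gF).
by apply: (memberZ gF); apply: (member_semi gF); exact: semi1.
Qed.

Lemma bracketX_horner c v g k : bracket g x = c *: x + v ->
  (bracketX_poly c v k).[x] = bracket g (x ^+ k).
Proof.
move=> gx; elim: k => [|k IH]; first by rewrite horner0 expr0 bracket1.
rewrite /= !hornerD hornerMX !hornerCM !hornerXn IH.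
rewrite exprS bracketMr gx mulrDl mulr_algl -scalerAl -addrA; congr (_ + _).
rewrite -IH horner_poly horner_coef mulr_suml mulr_sumr -big_split /=.
apply: eq_bigr => i _; rewrite -mulrA -exprSr exprS !mulrA -mulrDl.
by rewrite [_ * x]mulr_bracket subrK.
Qed.

Local Arguments bracketX_poly : simpl never.

(** [bracket g p.[x] = 0], rewritten with left coefficients. *)
Lemma relation_bracket g c v p m : g \in X -> member F v ->
    bracket g x = c *: x + v -> relation p -> (size p <= m.+2)%N ->
  exists q, [/\ relation q, (size q <= m.+2)%N,
    q`_m.+1 = bracket g p`_m.+1 + (m.+1%:R * c) *: p`_m.+1 &
    q`_m = bracket g p`_m + (m%:R * c) *: p`_m + m.+1%:R *: (p`_m.+1 * v)].
Proof.
move=> gX hv gx [hp p0] sp.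
pose q := \sum_(k < m.+2) ((bracket g p`_k)%:P * 'X^k + (p`_k)%:P *
  bracketX_poly c v k).
have qE i : q`_i = \sum_(k < m.+2)
    ((if i == k then bracket g p`_k else 0) + p`_k * (bracketX_poly c v k)`_i).
  rewrite coef_sum; apply: eq_bigr => k _; rewrite coefD !coefCM coefXn.
  by case: eqP => _; rewrite (mulr1, mulr0).
have low i : (m <= i)%N -> \sum_(k < m)
    ((if i == k then bracket g p`_k else 0) + p`_k * (bracketX_poly c v k)`_i)
      = 0.
  move=> le_mi; apply: big1 => k _; have lt_k := ltn_ord k.
  rewrite bracketX_high; last by lia.
  by case: eqP => [|_]; [lia | rewrite mulr0 addr0].
exists q; split.
- split=> [i|].
    rewrite qE; apply: (member_sum gF) => k _; apply: (memberD gF).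
      by case: eqP => _; [exact: (member_bracket gF) | exact: (member0 gF)].
    by apply: (memberM gF) => //; exact: bracketX_member.
  transitivity (bracket g p.[x]); last by rewrite p0 bracket0.
  rewrite horner_sum (horner_coef_wide _ sp) bracket_sum; apply: eq_bigr => k _.
  by rewrite hornerD !hornerCM hornerXn (bracketX_horner _ gx) bracketMr.
- apply/leq_sizeP => i le_i; rewrite qE; apply: big1 => k _.
  have lt_k := ltn_ord k; rewrite bracketX_high; last by lia.
  by case: eqP => [|_]; [lia | rewrite mulr0 addr0].
- rewrite qE 2!big_ord_recr /= low // add0r bracketX_high // eqxx bracketX_top.
  case: eqP => [|_]; first lia.
  by rewrite mulr0 addr0 add0r mulr_algr.
- rewrite qE 2!big_ord_recr /= low // add0r eqxx bracketX_top bracketX_subtop.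
  case: eqP => [|_]; first lia.
  by rewrite add0r mulr_algr -scalerAr.
Qed.

(** If [s x^(m+1) + s' x^m + ...] is a relation of minimal degree with [s]
    semi-invariant, then [(m+1) s x + s'] is semi-invariant, hence in the
    subalgebra; so are [s x] and, by saturation, [x]. *)
Lemma dependent_member p : p != 0 -> relation p -> member F x.
Proof.
move=> p0 relp.
pose small n := `[< exists q, [/\ q != 0, relation q & size q = n] >].
have ex_small : exists n, small n by exists (size p); apply/asboolP; exists p.
case: (ex_minnP ex_small) => n /asboolP[{p0 relp}p [p0 relp sp]] min_n.
have minimal q : relation q -> (size q < n)%N -> q = 0.
  move=> relq; apply: contraTeq => q0; rewrite -leqNgt; apply: min_n.
  by apply/asboolP; exists q.
case: n => [|[|m]] in sp min_n minimal.
- by move/eqP: sp; rewrite size_poly_eq0 (negPf p0).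
- have /eqP/size_poly1P[c c0 pc] := sp; case: relp => _.
  by rewrite pc hornerC => c00; rewrite c00 eqxx in c0.
pose lead b := exists q, [/\ relation q, (size q <= m.+2)%N & q`_m.+1 = b].
have [||||s [[q [relq sq qs]] s0 hs]] := @stable_semi lead p`_m.+1.
- move=> c u v [q1 [rel1 s1 <-]] [q2 [rel2 s2 <-]].
  exists (c%:A%:P * q1 + q2); split; first exact: relation_lin.
    apply/leq_sizeP => i le_i; rewrite coefD coefCM !nth_default ?mulr0 ?addr0
      //.
      exact: leq_trans s2 le_i.
    exact: leq_trans s1 le_i.
  by rewrite coefD coefCM mulr_algl.
- move=> g u gX [q1 [rel1 s1 <-]]; have [c hv] := x_tri gX.
  have gx : bracket g x = c *: x + (bracket g x - c *: x).
    by rewrite addrC subrK.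
  have [q2 [rel2 s2 top _]] := relation_bracket gX hv gx rel1 s1.
  exists ((- (m.+1%:R * c))%:A%:P * q1 + q2); split; first exact: relation_lin.
    apply/leq_sizeP => i le_i; rewrite coefD coefCM !nth_default ?mulr0 ?addr0
      //.
      exact: leq_trans s2 le_i.
    exact: leq_trans s1 le_i.
  by rewrite coefD coefCM mulr_algl top scaleNr addrC addrK.
- by exists p; rewrite sp.
- by rewrite -[m.+1]/(m.+2.-1) -sp -lead_coefE lead_coef_eq0.
have hy : semi_invariant (m.+1%:R *: (s * x) + q`_m).
  apply: semiP => g gX; have [c hv] := x_tri gX.
  move: (bracket g x - c *: x) hv (subrK (c *: x) (bracket g x)) => v hv.
  rewrite addrC => /esym gx; have [chi /(_ g gX) gs] := hs.
  have [q2 [rel2 s2 top subtop]] := relation_bracket gX hv gx relq sq.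
  exists (chi g + c).
  set d := chi g + m.+1%:R * c.
  (* The coefficient of index m of this vanishing relation is the eigenvalue
     equation sought. *)
  have : (- d)%:A%:P * q + q2 = 0.
    apply: minimal; first exact: relation_lin.
    rewrite ltnS; apply/leq_sizeP => i; rewrite leq_eqVlt => /predU1P[<-|lt_i].
      rewrite coefD coefCM mulr_algl top qs gs -scalerDl scaleNr.
      by rewrite addNr.
    by rewrite coefD coefCM !nth_default ?mulr0 ?addr0 //;
      apply: leq_trans lt_i.
  move/(congr1 (fun r : {poly A} => r`_m)).
  rewrite coefD coefCM coef0 mulr_algl subtop qs scaleNr => /eqP.
  rewrite addrC subr_eq0 => /eqP qm.
  have {}qm : m.+1%:R *: (s * v) + bracket g q`_m = (chi g + c) *: q`_m.
    apply: (addIr ((m%:R * c) *: q`_m)).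
    rewrite -addrA addrC qm -scalerDl /d.
    by rewrite -nat1r mulrDl mul1r addrA.
  rewrite bracketD bracketZ bracketMr gs gx mulrDr -scalerAl -scalerAr addrA
    -scalerDl.
  by rewrite scalerDr -addrA qm scalerDr !scalerA mulrC.
have [m0 hq] : member F q`_m by case: relq => hq _; exact: hq.
have : member F (m.+1%:R *: (s * x)).
  rewrite -[_ *: _](addrK q`_m) -scaleN1r addrC.
  by apply: (member_lin gF); [exists m0 | exact: (member_semi gF)].
move=> /((memberZ gF) m.+1%:R^-1); rewrite scalerA mulVf ?scale1r; last first.
  by have /pcharf0P -> := charK0.
by case=> n; exists n; apply: satF hs s0 _.
Qed.

End DependentGenerator.

(** * A good filtration of the whole algebra *)

(** The bound [w] on the degrees of the previous generators is carried along
    because it dictates the weight of [x]: it has to dominate the error term of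
    each [bracket g x]. *)
Lemma filtration_step F (w : nat) x l :
    good_filtration F -> x \in X -> (forall u, span l u -> F w u) ->
    (forall g, g \in X -> exists c, span l (bracket g x - c *: x)) ->
  exists2 F', good_filtration F' & exists w' : nat,
    forall u, span (x :: l) u -> F' w' u.
Proof.
move=> gF0 xX hw x_tri.
pose F1 := saturation F; have gF : good_filtration F1 := saturation_good gF0.
have {}hw u : span l u -> F1 w u by move=> /hw; exact: sub_saturation.
have split_span F' n : good_filtration F' -> (w <= n)%N -> F' n x ->
    (forall u, F1 w u -> F' w u) -> forall u, span (x :: l) u -> F' n u.
  move=> gF' le_wn hx sub u [c /hw/sub hu].
  rewrite -[u](subrK (c *: x)) addrC; apply: (gf_lin gF') => //.
  exact (gf_mono gF' le_wn hu).
have [[p [p0 relp]]|indep] := pselect (exists p, p != 0 /\ relation F1 x p).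
  have [|n hx] := dependent_member gF (@saturation_saturated F) xX _ p0 relp.
    by move=> g /x_tri[c hc]; exists c, w; exact: hw.
  exists F1 => //; exists (maxn n w).
  apply: split_span => //; first exact: leq_maxr.
  exact (gf_mono gF (leq_maxl n w) hx).
have gore : good_filtration (oreF F1 x w.+1).
  apply: ore_good => // [g /x_tri[c hc]|p hp p0].
    by exists c; apply: (gf_mono gF) (hw _ hc); lia.
  by apply/eqP/negPn/negP => pn0; apply: indep; exists p; split.
exists (oreF F1 x w.+1) => //; exists w.+2; apply: split_span => //;
  first by lia.
  by have := ore_X x w.+1 gF 1; rewrite mul1n expr1.
by move=> u; exact: ore_sub.
Qed.

Lemma flag_filtration l : {subset l <= X} -> flag l ->
  exists2 F, good_filtration F & exists w : nat, forall u, span l u -> F w u.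
Proof.
elim: l => [|x l IH] sub /=.
  exists base_filtration; first exact: base_filtration_good.
  by exists 0%N => u ->; exact: (gf_zero base_filtration_good).
case=> fl hx; have [y yl|//|F gF [w hw]] := IH.
  by apply: sub; rewrite inE yl orbT.
apply: filtration_step gF _ hw hx.
by apply: sub; rewrite mem_head.
Qed.

Theorem exhaustive_good_filtration :
  exists2 F, good_filtration F & forall u, exists n, F n u.
Proof.
have [//|//|F gF [w hw]] := @flag_filtration X.
exists F => //; apply: genX => [|c u v [m hu] [n hv]|u x xX [n hu]].
- by exists 1%N; apply: (gf_semi gF); exact: semi1.
- exact (member_lin gF c (ex_intro _ m hu) (ex_intro _ n hv)).
- exact (memberM gF (ex_intro _ n hu) (ex_intro _ w (hw _ (span_mem xX)))).
Qed.

(** * The descent *)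

Section Descent.
Variable F : nat -> A -> Prop.
Hypothesis gF : good_filtration F.
Hypothesis exF : forall u, exists n, F n u.

Lemma gfX_exact M k u : ~ F M u -> ~ F (k * M) (u ^+ k).
Proof.
move=> nu; elim: k => [|k IH].
  by rewrite expr0 => F1; have /eqP := gf_ord0 gF F1; rewrite oner_eq0.
rewrite exprS mulSn; have [m hu] := exF u; have [n huk] := exF (u ^+ k).
by case/(gf_dom gF hu huk).
Qed.

(** The Leibniz rule, where moving [bracket a v] to the right of the powers of
    [a] costs commutators only. *)
Lemma bracket_expr_lead a v M E i : F M.+1 a -> F E.+1 (bracket a v) ->
  F (i * M + E) (bracket (a ^+ i.+1) v - i.+1%:R *: (a ^+ i * bracket a v)).
Proof.
move=> ha he; elim: i => [|i IH].
  by rewrite expr1 expr0 mul1r scale1r subrr; exact: (gf0 gF).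
have -> : bracket (a ^+ i.+2) v - i.+2%:R *: (a ^+ i.+1 * bracket a v) =
    a * (bracket (a ^+ i.+1) v - i.+1%:R *: (a ^+ i * bracket a v)) +
    bracket (bracket a v) (a ^+ i.+1).
  rewrite [a ^+ i.+2]exprS bracketMl mulrBr -scalerAr mulrA -exprS.
  rewrite [bracket (bracket a v) _]bracketE /ad.
  rewrite -[i.+2]add1n natrD scalerDl scale1r opprD [RHS]addrACA.
  by congr (_ + _); exact: addrC.
apply: (gfD gF); first by apply: (gfM gF) ha IH _; lia.
by apply: (gf_bracket gF) he (gfX gF i.+1 ha) _; lia.
Qed.

Variables (f : {poly K}) (a : A).
Hypothesis deg_f : (1 < (size f).-1)%N.

Lemma horner_algE : horner_alg a f = \sum_(i < size f) f`_i *: a ^+ i.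
Proof.
rewrite /horner_alg /horner_morph (@horner_coef_wide _ (size f)); last first.
  exact: size_poly.
by apply: eq_bigr => i _; rewrite coef_map mulr_algl.
Qed.

Lemma bracket_horner_sum v :
  bracket (horner_alg a f) v = \sum_(i < size f) f`_i *: bracket (a ^+ i) v.
Proof.
rewrite horner_algE bracketC bracket_sum -sumrN; apply: eq_bigr => i _.
by rewrite bracketZ bracketC scalerN opprK.
Qed.

Lemma horner_alg_comm : horner_alg a f * a = a * horner_alg a f.
Proof.
rewrite horner_algE mulr_suml mulr_sumr; apply: eq_bigr => i _.
by rewrite -scalerAl -scalerAr -exprSr -exprS.
Qed.

Lemma bracket_bracket_comm u g v :
  u * g = g * u -> bracket u (bracket g v) = bracket g (bracket u v).
Proof.
move=> ug; rewrite [bracket g v]bracketE /ad bracketD bracketN !bracketMr.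
have -> : bracket u g = 0 by rewrite bracketE /ad ug subrr.
by rewrite mul0r mulr0 add0r addr0 [RHS]bracketE.
Qed.

(** The leading part of [bracket (horner_alg a f) v] is that of the derivative
    of [f] at [a] times [bracket a v], whose coefficient, the degree of [f]
    times its leading coefficient, is nonzero in characteristic zero; the lower
    powers of [a] do not compete because [a] has positive degree [M]. *)
Lemma bracket_horner_lead v M E : (0 < M)%N -> F M.+1 a -> ~ F M a ->
    F E.+1 (bracket a v) -> ~ F E (bracket a v) ->
  ~ F ((size f).-2 * M + E) (bracket (horner_alg a f) v).
Proof.
move=> M0 ha na he ne hfv.
case sf : (size f) deg_f hfv => [|[|[|d]]] // _; rewrite succnK /=.
rewrite bracket_horner_sum sf big_ord_recr /= => hsum.
have hlow : F (d.+1 * M + E)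
    (\sum_(i < d.+2) f`_i *: bracket (a ^+ i) v).
  apply: (gf_sum gF) => -[[|i] /= lt_i] _; apply: (gfZ gF).
    by rewrite expr0 bracketC bracket1 oppr0; exact: (gf0 gF).
  rewrite -[bracket _ v](subrK (i.+1%:R *: (a ^+ i * bracket a v))).
  apply: (gfD gF).
    by apply: (gf_mono gF) (bracket_expr_lead i ha he); nia.
  by apply: (gfZ gF); apply: (gfM gF) (gfX gF i ha) he _; nia.
have hd := bracket_expr_lead d.+1 ha he.
have fd0 : f`_d.+2 * d.+2%:R != 0.
  rewrite mulf_neq0 //; last by have /pcharf0P -> := charK0.
  by rewrite -[d.+2]/(d.+3.-1) -sf -lead_coefE lead_coef_eq0 -size_poly_eq0 sf.
have : F (d.+1 * M + E) (a ^+ d.+1 * bracket a v).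
  rewrite -[_ * _](scalerK fd0); apply: (gfZ gF); rewrite -scalerA.
  set t := _ *: (_ * _) in hd *; set b := bracket _ _ in hd hsum.
  have -> : t = b - (b - t) by rewrite subKr.
  rewrite scalerBr; apply: (gfB gF); last exact: (gfZ gF).
  by have := gfB gF hsum hlow; rewrite addrAC subrr add0r.
have [m ham] := exF (a ^+ d.+1).
case/(gf_dom gF ham he) => //; exact: gfX_exact.
Qed.

(** Induction on the degree of [v], applied to the eigenvector [bracket a v]. *)
Lemma eigenvector_eq0 lam v : lam != 0 ->
  bracket (horner_alg a f) v = lam *: v -> v = 0.
Proof.
move=> lam0; have [n0 hn0] := exF a.
have [ha|na] := pselect (F 1 a).
  have hfa : F 1 (horner_alg a f).
    rewrite horner_algE; apply: (gf_sum gF) => i _; apply: (gfZ gF).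
    by have := gfX gF i ha; rewrite muln0.
  move=> hv; apply/eqP/negPn/negP => v0; have [n hn] := exF v.
  have [m [hm nm]] := gf_exact gF hn v0; apply: nm.
  rewrite -(scalerK lam0 v) -hv; apply: (gfZ gF).
  by apply: (gf_bracket gF) hfa hm _; lia.
have mono i j : (i <= j)%N -> F i a -> F j a by exact: (gf_mono gF).
have [M [M0 haM naM]] := last_failure mono hn0 na.
have [n hn] := exF v; elim: n v hn => [|n IH] v hn hv;
  first exact: (gf_ord0 gF).
have he : bracket (horner_alg a f) (bracket a v) = lam *: bracket a v.
  by rewrite bracket_bracket_comm ?horner_alg_comm // hv bracketZ.
have [e0|e0] := eqVneq (bracket a v) 0.
  have aX i : bracket (a ^+ i) v = 0.
    elim: i => [|i IHi]; first by rewrite expr0 bracketC bracket1 oppr0.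
    by rewrite exprS bracketMl IHi e0 mulr0 mul0r addr0.
  apply: (scalerI lam0); rewrite -hv scaler0 bracket_horner_sum.
  by apply: big1 => i _; rewrite aX scaler0.
have [E0 hE0] := exF (bracket a v); have [E [hE nE]] := gf_exact gF hE0 e0.
have := bracket_horner_lead M0 haM naM hE nE; rewrite hv => nv.
suff e00 : bracket a v = 0 by rewrite e00 eqxx in e0.
apply: IH he; apply: (gf_mono gF) hE.
rewrite ltnNge; apply/negP => le_nE; apply: nv; apply: (gfZ gF).
by apply: (gf_mono gF) hn; have := deg_f; case: (size f) => [|[|[|d]]] //= _;
  nia.
Qed.

End Descent.

Theorem ad_horner_eigenvalue0 (f : {poly K}) (a v : A) (lam : K) :
  (1 < (size f).-1)%N -> v != 0 -> ad (horner_alg a f) v = lam *: v -> lam = 0.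
Proof.
move=> deg_f + hv; apply: contraNeq => lam0; apply/eqP.
have [F gF exF] := exhaustive_good_filtration.
by rewrite -bracketE in hv; exact: (eigenvector_eq0 gF exF deg_f lam0 hv).
Qed.

End TriangularGenerators.

(** * Prime factor algebras of enveloping algebras *)

Section FreeAlgebraGeneration.
Variables (K : fieldType) (Y : choiceType).

Lemma free_alg_ind (Q : free_alg K Y -> Prop) : Q 1 ->
    (forall c u v, Q u -> Q v -> Q (c *: u + v)) ->
    (forall u y, Q u -> Q (u * free_gen K y)) ->
  forall u, Q u.
Proof.
move=> Q1 Qlin Qgen.
have Q0 : Q 0 by have := Qlin (-1) 1 1 Q1 Q1; rewrite scaleN1r addNr.
have Qmon (s : seq Y) : Q << FMonom s >>.
  elim/last_ind: s => [|s y IH].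
    have -> : FMonom [::] = mone :> {fmonom Y} by apply: val_inj;
      rewrite /= fm1.
    exact: Q1.
  have -> : FMonom (rcons s y) = mmul (FMonom s) (fmu y) :> {fmonom Y}.
    by apply: val_inj; rewrite /= fmM fmU cats1.
  have -> : << mmul (FMonom s) (fmu y) >> = << FMonom s >> * free_gen K y :>
    free_alg K Y.
    by rewrite /free_gen malgM_def fgmulUU mulr1.
  exact: Qgen.
move=> u; have -> : u = \sum_(k <- msupp u) u@_k *: << k >>.
  rewrite {1}[u]monalgE; apply: eq_bigr => k _; apply/malgP => k'.
  by rewrite mcoeffZ !mcoeffU; case: eqP; rewrite ?mulr1 ?mulr0.
apply: big_ind => [//|v w hv hw|[s] _].
  by rewrite -[v]scale1r; exact: Qlin.
by rewrite -[_ *: _]addr0; exact: Qlin.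
Qed.

End FreeAlgebraGeneration.

Section PrimeQuotient.
Variables (K : fieldType) (A : algType K) (P : proper_ideal2 A).

(** Primeness in terms of elements follows from the version with ideals applied
    to [J], the annihilator of [x A] modulo [P], and [I], the left annihilator
    of [J] modulo [P]. *)
Lemma prime_quot_cancel : prime_ideal2 P -> forall u v : alg_quot P,
  (forall r, u * r * v = 0) -> u = 0 \/ v = 0.
Proof.
move=> [[P0 PB Pl Pr] P1 primeP] u v.
have [x <-] := alg_pi_surj u; have [y <-] := alg_pi_surj v => xry.
have piP z : (alg_pi P z = 0) <-> (z \in (P : {pred A})).
  by rewrite -alg_pi_eq0; split=> [->|/eqP].
pose J : {pred A} := fun z => `[< forall r, x * r * z \in (P : {pred A}) >].
pose I : {pred A} := fun z => `[< forall t, t \in J ->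
  z * t \in (P : {pred A}) >].
have JP z : reflect (forall r, x * r * z \in (P : {pred A})) (z \in J) by
  exact: asboolP.
have IP z : reflect (forall t, t \in J -> z * t \in (P : {pred A})) (z \in I).
  exact: asboolP.
have cJ : ideal2_closed J.
  split.
  - by apply/JP => r; rewrite mulr0.
  - by move=> s t /JP hs /JP ht; apply/JP => r; rewrite mulrBr PB.
  - by move=> b s /JP hs; apply/JP => r; rewrite mulrA -[x * r * b]mulrA.
  - by move=> b s /JP hs; apply/JP => r; rewrite mulrA Pr.
have cI : ideal2_closed I.
  case: cJ => _ _ Jl _; split.
  - by apply/IP => t _; rewrite mul0r.
  - by move=> s t /IP hs /IP ht; apply/IP => z hz; rewrite mulrBl PB ?hs ?ht.
  - by move=> b s /IP hs; apply/IP => z hz; rewrite -mulrA Pl ?hs.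
  - by move=> b s /IP hs; apply/IP => z hz; rewrite -mulrA hs ?Jl.
have xI : x \in I by apply/IP => t /JP/(_ 1); rewrite mulr1.
have yJ : y \in J by apply/JP => r; apply/piP; rewrite !rmorphM.
have IJP s t : s \in I -> t \in J -> s * t \in (P : {pred A}).
  by move=> /IP hs /hs.
have [/(_ x xI)/piP hx|/(_ y yJ)/piP hy] := primeP I J cI cJ IJP; first by left.
by right.
Qed.

End PrimeQuotient.

Section EnvelopingQuotient.
Variables (K : fieldType) (G : lieAlgType K).
Variable P : proper_ideal2 (enveloping_alg G).

Definition quot_incl (x : G) : alg_quot P := alg_pi P (enveloping_incl x).

Lemma quot_incl_linear : linear quot_incl.
Proof. by move=> c x y; rewrite /quot_incl enveloping_incl_linear linearP. Qed.

Lemma quot_incl_lie x y :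
  quot_incl (lie x y) = bracket (quot_incl x) (quot_incl y).
Proof. by rewrite /quot_incl enveloping_incl_lie rmorphB !rmorphM bracketE. Qed.

Lemma quot_ind (Q : alg_quot P -> Prop) : Q 1 ->
    (forall c u v, Q u -> Q v -> Q (c *: u + v)) ->
    (forall u x, Q u -> Q (u * quot_incl x)) ->
  forall u, Q u.
Proof.
move=> Q1 Qlin Qgen u; have [w <-] := alg_pi_surj u.
have [r <-] := alg_pi_surj w; move: r.
apply: free_alg_ind => [|c r t hr ht|r y hr]; first by rewrite !rmorph1.
  by rewrite !linearP; exact: Qlin.
by rewrite !rmorphM; exact: Qgen.
Qed.

(** A basis adapted to the chain of ideals, listed from the last element: the
    bracket with [x] in the ideal of rank [i.+1] stays in this ideal, which is
    the ideal of rank [i] plus the line of [x]. *)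
Lemma completely_solvable_flag : completely_solvable G ->
  exists l : seq G, (forall u, span (map quot_incl l) (quot_incl u)) /\
    forall m, flag (map quot_incl m) (map quot_incl l).
Proof.
move=> [c [c0 cn cS ci]].
suff flagc i : (i <= \dim {:G})%N -> exists l : seq G,
    (forall u, u \in c i -> span (map quot_incl l) (quot_incl u)) /\
    forall m, flag (map quot_incl m) (map quot_incl l).
  have [l [hl fl]] := flagc _ (leqnn _); exists l; split=> // u.
  by apply: hl; rewrite cn memvf.
elim: i => [_|i IH lt_i].
  exists [::]; split=> // u; rewrite c0 memv0 => /eqP ->.
  by have /= := quot_incl_linear (-1) 0 0; rewrite scaler0 addr0 scaleN1r addNr.
have [l [hl fl]] := IH (ltnW lt_i).
have [_ dim_i] := ci i (ltnW lt_i); have [idS dimS] := ci i.+1 lt_i.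
have /subvPn[x xS xi] : ~~ (c i.+1 <= c i)%VS.
  by apply/negP => /dimvS; rewrite dim_i dimS ltnn.
have cSE : c i.+1 = (c i + <[x]>)%VS.
  apply/esym/eqP; rewrite eqEdim subv_add cS // -memvE xS /= dimS -[in X in (X
    <= _)%N]dim_i.
  rewrite ltnNge; apply: contra xi => le_dim.
  have : (c i == c i + <[x]>)%VS by rewrite eqEdim addvSl.
  by move=> /eqP ->; apply: (subvP (addvSr _ _)); exact: memv_line.
have dec u : u \in c i.+1 -> exists t, span (map quot_incl l) (quot_incl u - t
  *: quot_incl x).
  rewrite cSE => /memv_addP[y yi [z /vlineP[t ->] ->]]; exists t.
  by rewrite [y + _]addrC quot_incl_linear addrAC subrr add0r; exact: hl.
exists (x :: l); split=> [u /dec//|m] /=; split=> // g /mapP[y _ ->].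
by rewrite -quot_incl_lie; apply: dec; exact: idS.
Qed.

End EnvelopingQuotient.

Theorem corollary2p6 (K : fieldType) (charK0 : [pchar K] =i pred0)
    (G : lieAlgType K) (solvG : completely_solvable G)
    (P : proper_ideal2 (enveloping_alg G)) (primeP : prime_ideal2 P)
    (a : alg_quot P) (f : {poly K}) (deg_f : (1 < (size f).-1)%N)
    (lambda : K) :
  is_eigenvalue (ad (horner_alg a f)) lambda <-> lambda = 0.
Proof.
split=> [[v v0 hv]|->]; last first.
  by exists 1; rewrite ?oner_neq0 // /ad mulr1 mul1r subrr scale0r.
have [l [hl fl]] := completely_solvable_flag P solvG.
apply: (ad_horner_eigenvalue0 (fl l)) deg_f v0 hv => //; last first.
  exact: prime_quot_cancel.
move=> Q Q1 Qlin Qgen; apply: quot_ind => // u x hu.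
have Q0 : Q 0 by have := Qlin (-1) 1 1 Q1 Q1; rewrite scaleN1r addNr.
have {}Qgen y : y \in map (quot_incl P) l -> Q (u * y) by move=> /Qgen; apply.
elim: (map _ l) (quot_incl P x) (hl x) Qgen => [|e m IH] y /=.
  by move=> -> _; rewrite mulr0.
move=> [c hy] Qe; rewrite -[y](subrK (c *: e)) addrC mulrDr -scalerAr.
apply: Qlin; first by apply: Qe; rewrite mem_head.
by apply: IH hy _ => z zm; apply: Qe; rewrite inE zm orbT.
Qed.
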